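(* Let $M\in\mathbb{R}\setminus\{0\}$ and let $L,T>0$ be such that $T<L/|M|$. Then $$\frac{1}{\sqrt{\varepsilon}}\,K(\varepsilon,T,L,M)\to\infty\quad\text{as }\varepsilon\to0^+,$$ where $K(\varepsilon,T,L,M)$ is the cost of null controllability defined in the context.
   Context: For $\varepsilon,T,L>0$ and $M\in\mathbb{R}\setminus\{0\}$, put $\delta=-2\varepsilon^{2/3}M^{1/3}$ (real cube root), $By=\varepsilon y_{xx}+\frac{\delta}{2}y_x$ and $B^*\varphi=\varepsilon\varphi_{xx}-\frac{\delta}{2}\varphi_x$. Consider the control system $$\begin{cases} y_t+\varepsilon y_{xxxx}+\delta y_{xxx}+My_x=0, & (t,x)\in(0,T)\times(0,L),\\ y(t,0)=0,\quad y(t,L)=0, & t\in(0,T),\\ By(t,0)=u(t),\quad By(t,L)=0, & t\in(0,T),\\ y(0,x)=y_0(x), & x\in(0,L).\end{cases}$$ Solutions are defined by transposition. For $t\in(0,T]$ and $\varphi_0\in L^2(0,L)$, let $\varphi\in C([0,t];L^2(0,L))\cap L^2(0,t;H^2\cap H^1_0(0,L))$ be the solution of the (backward) adjoint system on $(0,t)\times(0,L)$: $$-\varphi_s+\varepsilon\varphi_{xxxx}-\delta\varphi_{xxx}-M\varphi_x=0,\quad \varphi(s,0)=\varphi(s,L)=0,\quad B^*\varphi(s,0)=B^*\varphi(s,L)=0,\quad \varphi(t,\cdot)=\varphi_0.$$ Given $y_0\in L^2(0,L)$ and $u\in L^2(0,T)$, a solution of the control system is a function $y=y(t,x)$ such that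 for every $t\in[0,T]$ one has $y(t,\cdot)\in L^2(0,L)$ and $$\int_0^L y(t,x)\varphi_0(x)\,dx=\int_0^L y_0(x)\varphi(0,x)\,dx+\int_0^t u(s)\varphi_x(s,0)\,ds$$ for every $\varphi_0\in L^2(0,L)$. For each $y_0\in L^2(0,L)$ and $u\in L^2(0,T)$ there is exactly one solution $y\in C([0,T];L^2(0,L))$. For $y_0\in L^2(0,L)$ let $U(\varepsilon,T,L,M,y_0)$ be the set of all $u\in L^2(0,T)$ whose corresponding solution satisfies $y(T,\cdot)=0$ (this set is nonempty). The cost of null controllability is $$K(\varepsilon,T,L,M)=\sup_{\|y_0\|_{L^2(0,L)}\le1}\ \inf\{\|u\|_{L^2(0,T)}: u\in U(\varepsilon,T,L,M,y_0)\}.$$ *)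

(* Defs.v *)
From HB Require Import structures.
From mathcomp Require Export all_boot all_order all_algebra.
From mathcomp Require Export all_classical all_reals all_analysis.

Set Implicit Arguments.
Unset Strict Implicit.
Unset Printing Implicit Defensive.
Export Order.TTheory GRing.Theory Num.Theory.
Export numFieldNormedType.Exports.

Local Open Scope classical_set_scope.
Local Open Scope ring_scope.

Section SquareIntegrable.
Context {d : measure_display} {T : measurableType d} {R : realType}.
Variable mu : {measure set T -> \bar R}.

(* Elements of L^2(D) are represented by functions on the whole type, of which
   only the restriction to D (extended by 0) matters. *)
Definition L2on (D : set T) (f : T -> R) : Prop := f \_ D \in Lfun mu 2%:E.

Definition L2norm (D : set T) (f : T -> R) : \bar R :=
  'N[mu]_2%:E[EFin \o f \_ D].

End SquareIntegrable.

Section Control.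
Context {R : realType}.
Local Notation mu := (@lebesgue_measure R).

Definition cbrt (x : R) : R := Num.sg x * `|x| `^ 3^-1.

Definition delta (eps M : R) : R := - 2 * eps `^ (2 / 3) * cbrt M.

(* f is the C^1([0,L]) representative of an element of H^2(0,L), with
   derivative f1 and weak second derivative f2: f and f1 are absolutely
   continuous on [0,L] and f2 is square integrable. *)
Definition H2 (L : R) (f f1 f2 : R -> R) : Prop :=
  [/\ L2on mu `]0, L[ f2,
      forall x, x \in `[0, L] -> f1 x = f1 0 + \int[mu]_(z in `[0, x]) f2 z
    & forall x, x \in `[0, L] -> f x = f 0 + \int[mu]_(z in `[0, x]) f1 z].

Definition H2_H10 (L : R) (f f1 f2 : R -> R) : Prop :=
  [/\ H2 L f f1 f2, f 0 = 0 & f L = 0].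

(* B^* f, in terms of f1 = f_x and f2 = f_xx. *)
Definition Bstar (eps M : R) (f1 f2 : R -> R) (x : R) : R :=
  eps * f2 x - delta eps M / 2 * f1 x.

(* Variational form of the spatial operator
     f |-> eps f_xxxx - delta f_xxx - M f_x
         = (B^* f)_xx - (delta / 2) f_xxx - M f_x
   with f = 0 and B^* f = 0 at both ends, tested against psi in H^2 /\ H^1_0.
   Integrating by parts, twice in the first term and once in the second, the
   boundary terms are those of (B^* f)_x psi, - (B^* f) psi_x and f_xx psi;
   they vanish as B^* f = 0 and psi = 0 at 0 and L.  As psi_x is free at the end
   points, the condition B^* f = 0 is a natural boundary condition: it is
   implied by testing with all psi. *)
Definition adjoint_form (eps L M : R) (f1 f2 psi psi1 psi2 : R -> R) : R :=
  \int[mu]_(x in `]0, L[)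
    (Bstar eps M f1 f2 x * psi2 x + delta eps M / 2 * f2 x * psi1 x
     - M * f1 x * psi x).

(* phi is the solution in C([0,t]; L^2) /\ L^2(0,t; H^2 /\ H^1_0) of the
   backward adjoint system on (0,t) x (0,L) with final datum phi0; phi1 and phi2
   are phi_x and phi_xx.  The equation is the usual weak one,
   (phi_s(s), psi) = adjoint_form (phi(s), psi) for psi in H^2 /\ H^1_0,
   integrated in time. *)
Record adjoint_solution (eps L M t : R) (phi0 : R -> R)
    (phi phi1 phi2 : R -> R -> R) : Prop := {
  adj_L2 : forall s, s \in `[0, t] -> L2on mu `]0, L[ (phi s);
  adj_cont : forall s0, s0 \in `[0, t] ->
    L2norm mu `]0, L[ (phi s \- phi s0)
      @[s --> within `[0, t] (nbhs s0)] --> 0%E;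
  adj_H2 : {ae mu, forall s, s \in `]0, t[ ->
    H2_H10 L (phi s) (phi1 s) (phi2 s)};
  adj_L2H2 : forall f, f = phi \/ f = phi1 \/ f = phi2 ->
    L2on (mu \x mu)%E (`]0, t[ `*` `]0, L[) (fun z => f z.1 z.2);
  adj_eq : forall s psi psi1 psi2, s \in `[0, t] -> H2_H10 L psi psi1 psi2 ->
    \int[mu]_(x in `]0, L[) (phi t x * psi x)
      - \int[mu]_(x in `]0, L[) (phi s x * psi x)
    = \int[mu]_(r in `]s, t[)
        adjoint_form eps L M (phi1 r) (phi2 r) psi psi1 psi2;
  adj_final : {ae mu, forall x, x \in `]0, L[ -> phi t x = phi0 x}
}.

(* Solution by transposition of the control system with initial datum y0 and
   boundary control By(t,0) = u(t).  For t = 0 the identity reduces to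
   y(0,.) = y0. *)
Definition control_solution (eps T L M : R) (y0 u : R -> R)
    (y : R -> R -> R) : Prop :=
  forall t, t \in `[0, T] ->
    L2on mu `]0, L[ (y t) /\
    forall phi0 phi phi1 phi2, L2on mu `]0, L[ phi0 ->
      adjoint_solution eps L M t phi0 phi phi1 phi2 ->
      \int[mu]_(x in `]0, L[) (y t x * phi0 x) =
        \int[mu]_(x in `]0, L[) (y0 x * phi 0 x)
        + \int[mu]_(s in `]0, t[) (u s * phi1 s 0).

Definition null_controls (eps T L M : R) (y0 : R -> R) : set (R -> R) :=
  [set u | L2on mu `]0, T[ u /\
     exists y, control_solution eps T L M y0 u y /\
       {ae mu, forall x, x \in `]0, L[ -> y T x = 0}].

Definition control_cost (eps T L M : R) : \bar R :=
  ereal_sup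
    [set ereal_inf [set L2norm mu `]0, T[ u | u in null_controls eps T L M y0]
       | y0 in [set y0 : R -> R | L2on mu `]0, L[ y0 /\
                         (L2norm mu `]0%R, L[ y0 <= 1)%E]].

End Control.

(* Main.v *)
Require Import Defs.
From mathcomp Require Import ring lra measurable_realfun.

(** Null controls are bounded below by duality. If [u] steers [y0] to zero, then for
    every solution [phi] of the backward adjoint system the integral of
    [u * phi_x(., 0)] over the time interval is the opposite of the scalar product of
    [y0] and [phi(0)] ([null_control_duality]). By the Cauchy-Schwarz inequality it
    suffices to find, for each small [eps], an adjoint solution for which this scalar
    product stays away from zero while [sqrt eps * phi_x(., 0)] tends to zero in
    [L^2(0,T)].

    Formally, as [eps] tends to zero the adjoint equation becomes the transport
    equation [phi_s + M phi_x = 0]. Because [T < L / |M|] there is a bump [g] with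
    support in [(0, L)] whose transport along the characteristics remains supported in
    [(0, L)] over the whole interval [[0, T]]; the transported bump never sees the
    boundary. An adjoint solution with final datum close to [g] should stay close to
    it. The energy identity makes this precise. The boundary conditions are such that
    the energy satisfies [E' = 2 eps |phi_xx|^2] ([energy_balance]), and the trace
    satisfies [phi_x(0)^2 <= L/3 |phi_xx|^2] ([trace_bound]), so that [eps] times the
    squared trace is controlled by [E(T) - E(0)] alone. The scalar product [D(s)] of
    [phi(s)] with the transported bump varies only by [O(eps + |delta|)], that is
    [O(eps^(2/3))], after integrating the third and fourth derivatives by parts onto the
    bump ([pairing_variation]). Expanding the squared distance between [phi] and the
    transported bump at both ends gives [E(T) <= 2 D(T) - |g|^2 + o(1)] and
    [E(0) >= 2 D(0) - |g|^2], hence [E(T) - E(0) = o(1)], while [D(0)] is bounded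
    below by a fixed fraction of [|g|^2] ([trace_pairing_bounds]). The initial datum is a multiple of the transported
    bump at time [0]. The argument treats both signs of [M] alike.

    No existence theory for the adjoint system is required. The value of [delta]
    makes the spatial operator a polynomial in [B^*], so that the functions
    [exp (a x) sin (k pi x / L)] with [a = delta / (4 eps)] are eigenfunctions
    satisfying all the boundary conditions ([smooth_adjoint_mode]); finite combinations
    of the corresponding modes are smooth solutions, they are solutions in the
    variational sense ([adjoint_solution_smooth]), and their final data are dense by
    the Weierstrass theorem in the variable [cos (pi x / L)]
    ([profile_approximation]). *)

Set Implicit Arguments.
Unset Strict Implicit.
Unset Printing Implicit Defensive.

Local Open Scope classical_set_scope.
Local Open Scope ring_scope.

(** * Calculus on the line *)

Section derivatives.
Context {R : realType}.
Implicit Types (f g : R -> R) (x c : R).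

Lemma is_derive_comp f g x (df dg : R) : is_derive x 1 f df ->
  is_derive (f x) 1 g dg -> is_derive x 1 (fun y => g (f y)) (dg * df).
Proof.
move=> hf hg; apply: is_derive_eq (@is_derive1_comp _ g f x _ _ hg hf) _.
by rewrite mulrC.
Qed.

End derivatives.

Section continuity.
Context {R : realType} {T : topologicalType}.
Implicit Types (f g : T -> R).

Lemma continuous_cst (c : R) : continuous (fun _ : T => c).
Proof. exact: cst_continuous. Qed.

Lemma continuous_add f g : continuous f -> continuous g ->
  continuous (fun x => f x + g x).
Proof. by move=> cf cg x; apply: continuousD; [exact: cf|exact: cg]. Qed.

Lemma continuous_opp f : continuous f -> continuous (fun x => - f x).
Proof. by move=> cf x; apply: continuousN; exact: cf. Qed.

Lemma continuous_mul f g : continuous f -> continuous g ->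
  continuous (fun x => f x * g x).
Proof. by move=> cf cg x; apply: continuousM; [exact: cf|exact: cg]. Qed.

Lemma continuous_sqr f : continuous f -> continuous (fun x => f x ^+ 2).
Proof. exact: (fun cf => continuous_mul cf cf). Qed.

End continuity.

(** Proves the continuity of polynomial expressions; [tac] deals with the
    non-polynomial leaves. *)
Ltac continuity_by tac := match goal with
  | |- forall x, continuous_at x (fun y => @Algebra.add _ (@?f y) (@?g y)) =>
      refine (continuous_add _ _); continuity_by tac
  | |- forall x, continuous_at x (fun y => @Algebra.opp _ (@?f y)) =>
      refine (continuous_opp _); continuity_by tac
  | |- forall x, continuous_at x (fun y => @GRing.mul _ (@?f y) (@?g y)) =>
      refine (continuous_mul _ _); continuity_by tac
  | |- forall x, continuous_at x (fun y => @GRing.exp _ (@?f y) _) =>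
      refine (continuous_sqr _); continuity_by tac
  | _ => solve [exact: continuous_cst | tac | assumption | exact: oppr_continuous
           | move=> ?; first [exact: cvg_id | exact: cvg_fst | exact: cvg_snd]]
  end.

Section tools.
Context {R : realType}.
Local Notation mu := (@lebesgue_measure R).
Implicit Types (f F w : R -> R) (a b : R).

Lemma is_derive_continuous F f :
  (forall x : R, is_derive x 1 F (f x)) -> continuous F.
Proof.
move=> dF x; apply: differentiable_continuous; apply/derivable1_diffP.
by have [] := dF x.
Qed.

Lemma integrable_cc f a b : continuous f -> mu.-integrable `[a, b] (EFin \o f).
Proof.
move=> cf; apply: continuous_compact_integrable; first exact: segment_compact.
exact: continuous_subspaceT.
Qed.

Lemma integrable_oo f a b : continuous f -> mu.-integrable `]a, b[ (EFin \o f).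
Proof.
move=> cf; apply: (integrableS _ _ _ (integrable_cc a b cf)) => //.
exact: subset_itv_oo_cc.
Qed.

(** Weak formulations use open intervals and primitives closed ones; this and the
    next lemmas let everything be computed on open intervals. *)
Lemma Rintegral_oo_cc f a b : mu.-integrable `]a, b[ (EFin \o f) ->
  \int[mu]_(x in `]a, b[) f x = \int[mu]_(x in `[a, b]) f x.
Proof.
case/integrableP => mf _; rewrite /Rintegral.
by rewrite [in RHS](@integral_itv_bndoo _ _ _ (EFin \o f)).
Qed.

Lemma Rintegral_FTC F f a b : a <= b ->
  (forall x : R, is_derive x 1 F (f x)) -> continuous f ->
  \int[mu]_(x in `]a, b[) f x = F b - F a.
Proof.
rewrite le_eqVlt => /predU1P[-> *|ab dF cf].
  by rewrite set_itv_ge ?bnd_simp ?ltxx// Rintegral_set0 subrr.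
rewrite Rintegral_oo_cc; last exact: integrable_oo.
rewrite /Rintegral (@continuous_FTC2 _ f F)//.
- exact: continuous_subspaceT.
- have cF := is_derive_continuous dF.
  split=> [x _| |]; first by have [] := dF x.
  + exact/cvg_at_right_filter/cF.
  + exact/cvg_at_left_filter/cF.
- by move=> x _; rewrite derive1E; exact: derive_val.
Qed.

(** Joint continuity gives, on compact rectangles, the domination that the passages
    to the limit under the integral sign below require. *)
Lemma bounded_rectangle (F : R * R -> R) (u v a b : R) : continuous F ->
  exists2 C, 0 <= C & forall s x, s \in `[u, v] -> x \in `[a, b] -> `|F (s, x)| <= C.
Proof.
move=> cF.
have cK : compact (`[u, v] `*` `[a, b] : set (R * R)).
  by apply: compact_setX; exact: segment_compact.
have /compact_bounded[r [_ rF]] : compact (F @` (`[u, v] `*` `[a, b])).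
  by apply: continuous_compact => //; exact: continuous_subspaceT.
exists (Num.max 0 (r + 1)); first by rewrite le_max lexx.
move=> s x sI xI; rewrite le_max; apply/orP; right.
by apply: rF; rewrite ?ltrDl//=; exists (s, x).
Qed.

Lemma integrable_mul_bounded w (G : R -> R) (a b : R) :
  mu.-integrable `]a, b[ (EFin \o w) -> continuous G ->
  mu.-integrable `]a, b[ (EFin \o (fun x => G x * w x)).
Proof.
move=> iw cG.
have [D D0 hD] : exists2 D, 0 <= D & forall x, x \in `[a, b] -> `|G x| <= D.
  have cG2 : continuous (fun z : R * R => G z.2).
    by move=> z; apply: continuous_comp; [exact: cvg_snd|exact: cG].
  have [D D0 hD] := bounded_rectangle 0 0 a b cG2.
  by exists D => // x xI; apply: (hD 0) => //; rewrite in_itv/= lexx.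
apply: (le_integrable _ _ _ (integrableZl _ D iw)) => //=.
- apply/measurable_EFinP/measurable_funM.
  + by apply: measurable_funTS; exact: continuous_measurable_fun.
  + by apply/measurable_EFinP; case/integrableP: iw.
- move=> x xI; rewrite lee_fin normrM [leRHS]normrM ler_wpM2r//.
  rewrite (ger0_norm D0); apply: hD; exact: subset_itv_oo_cc.
Qed.

Lemma integrable_scale_norm w (C a b : R) : mu.-integrable `]a, b[ (EFin \o w) ->
  mu.-integrable `]a, b[ (EFin \o (fun x => C * `|w x|)).
Proof.
move=> iw; have := @integrableZl _ _ _ mu `]a, b[ _ C _ (integrable_norm iw).
by apply.
Qed.

Lemma continuous_pair (T U V : topologicalType) (f : T -> U) (g : T -> V) :
  continuous f -> continuous g -> continuous (fun x => (f x, g x)).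
Proof.
move=> cf cg x.
exact: (@cvg_pair _ _ _ (nbhs x) (nbhs (f x)) (nbhs (g x)) _ _ _ _ _ (cf x) (cg x)).
Qed.

Lemma continuous_sliceR (F : R * R -> R) s :
  continuous F -> continuous (fun x => F (s, x)).
Proof.
move=> cF x; apply: (@continuous_comp _ _ _ (fun x => (s, x)) F); last exact: cF.
by apply: continuous_pair => z; [exact: cst_continuous|exact: cvg_id].
Qed.

Lemma continuous_sliceL (F : R * R -> R) x :
  continuous F -> continuous (fun s => F (s, x)).
Proof.
move=> cF s; apply: (@continuous_comp _ _ _ (fun s => (s, x)) F); last exact: cF.
by apply: continuous_pair => z; [exact: cvg_id|exact: cst_continuous].
Qed.

Lemma continuous_Rintegral (F : R * R -> R) w a b : continuous F ->
  mu.-integrable `]a, b[ (EFin \o w) ->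
  continuous (fun s => \int[mu]_(x in `]a, b[) (F (s, x) * w x)).
Proof.
move=> cF iw s.
have [C C0 hC] := bounded_rectangle (s - 1) (s + 1) a b cF.
apply: (@continuity_under_integral _ _ _ mu (fun s x => F (s, x) * w x) `]a, b[
  _ (s - 1) (s + 1) _ _ (fun x => C * `|w x|)) => //.
- move=> r _; apply: integrable_mul_bounded => //; exact: continuous_sliceR.
- apply/aeW => y _ r _; apply: continuousM; last exact: cst_continuous.
  exact: continuous_sliceL.
- exact: integrable_scale_norm.
- move=> r rI; apply/aeW => y yI; rewrite normrM ler_wpM2r//.
  by apply: hC; exact: subset_itv_oo_cc.
- by rewrite inE/= in_itv/=; apply/andP; split; lra.
Qed.

Lemma is_derive_Rintegral (F F' : R * R -> R) w a b :
  continuous F -> continuous F' ->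
  (forall s x : R, is_derive s 1 (fun r => F (r, x)) (F' (s, x))) ->
  mu.-integrable `]a, b[ (EFin \o w) ->
  forall s : R, is_derive s 1 (fun s => \int[mu]_(x in `]a, b[) (F (s, x) * w x))
    (\int[mu]_(x in `]a, b[) (F' (s, x) * w x)).
Proof.
move=> cF cF' dF iw s.
have [C C0 hC] := bounded_rectangle (s - 1) (s + 1) a b cF'.
have sI : `]s - 1, s + 1[%classic s by rewrite /= in_itv/=; apply/andP; split; lra.
have dFw (r y : R) : is_derive r 1 (fun r => F (r, y) * w y) (F' (r, y) * w y).
  have := @is_deriveM _ _ (fun r => F (r, y)) (cst (w y)) r 1 _ _ (dF r y) (is_derive_cst _ _ _).
  by rewrite scaler0 add0r /= => h; apply: is_derive_eq; rewrite mulrC.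
have p1 (r y : R) : partial1of2 (fun s x => F (s, x) * w x) r y = F' (r, y) * w y.
  by rewrite partial1of2E; exact: derive_val.
have iF r : mu.-integrable `]a, b[ (EFin \o (fun x => F (r, x) * w x)).
  by apply: integrable_mul_bounded => //; exact: continuous_sliceR.
have H1 : forall x y, `]s - 1, s + 1[%classic x -> `]a, b[%classic y ->
    derivable ((fun s x => F (s, x) * w x) ^~ y) x 1.
  by move=> x y _ _; have [] := dFw x y.
have H2 : forall x y, `]s - 1, s + 1[%classic x -> `]a, b[%classic y ->
    `|partial1of2 (fun s x => F (s, x) * w x) x y| <= C * `|w y|.
  move=> r y rI yI; rewrite p1 normrM ler_wpM2r//.
  by apply: hC; exact: subset_itv_oo_cc.
have G0 y : 0 <= C * `|w y| by rewrite mulr_ge0.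
have iG : mu.-integrable `]a, b[ (EFin \o (fun y => C * `|w y|)).
  exact: integrable_scale_norm.
have mB : measurable (`]a, b[ : set R) by [].
have := @derivable_under_integral R _ _ mu (fun s x => F (s, x) * w x) `]a, b[ mB s
  (s - 1) (s + 1) sI (fun r _ => iF r) H1 (fun y => C * `|w y|) G0 iG H2.
have := @differentiation_under_integral R _ _ mu (fun s x => F (s, x) * w x) `]a, b[ mB s
  (s - 1) (s + 1) sI (fun r _ => iF r) H1 (fun y => C * `|w y|) G0 iG H2.
rewrite derive1E => e d; apply: DeriveDef => //; rewrite e.
by apply: eq_Rintegral => y _; rewrite p1.
Qed.

Lemma Rintegral_mulr1 f a b :
  \int[mu]_(x in `]a, b[) f x = \int[mu]_(x in `]a, b[) (f x * 1).
Proof. by apply: eq_Rintegral => x _; rewrite mulr1. Qed.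

Lemma continuous_Rintegral1 (F : R * R -> R) a b : continuous F ->
  continuous (fun s => \int[mu]_(x in `]a, b[) F (s, x)).
Proof.
move=> cF; under eq_fun do rewrite Rintegral_mulr1.
by apply: (continuous_Rintegral (w := fun=> 1)) => //; apply: integrable_oo; exact: cst_continuous.
Qed.

Lemma is_derive_Rintegral1 (F F' : R * R -> R) a b :
  continuous F -> continuous F' ->
  (forall s x : R, is_derive s 1 (fun r => F (r, x)) (F' (s, x))) ->
  forall s : R, is_derive s 1 (fun s => \int[mu]_(x in `]a, b[) F (s, x))
    (\int[mu]_(x in `]a, b[) F' (s, x)).
Proof.
move=> cF cF' dF s; under eq_fun do rewrite Rintegral_mulr1.
rewrite Rintegral_mulr1.
by apply: (is_derive_Rintegral (w := fun=> 1)) => //; apply: integrable_oo; exact: cst_continuous.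
Qed.

(** Solutions are followed along the lines [x + d * s = const] of the transport
    equation. *)
Lemma continuous_line (F : R * R -> R) (c d : R) : continuous F ->
  continuous (fun z : R * R => F (z.1, z.2 - c + d * z.1)).
Proof.
move=> cF z; apply: (@continuous_comp _ _ _ (fun z : R * R => (z.1, z.2 - c + d * z.1)) F); last exact: cF.
apply: continuous_pair => {}z; first exact: cvg_fst.
by move: z; continuity_by idtac.
Qed.

End tools.

Arguments continuous_sliceL {R F} x cF _ _ _.
Arguments continuous_sliceR {R F} s cF _ _ _.
Arguments continuous_line {R F} c d cF _ _ _.

(** * Smooth solutions of the adjoint system: energy and trace *)

Section smooth.
Context {R : realType}.
Local Notation mu := (@lebesgue_measure R).

Definition spatial_op (eps M : R) (f : nat -> R -> R) (x : R) : R :=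
  eps * f 4%N x - delta eps M * f 3%N x - M * f 1%N x.

(** Integrating by parts produces the boundary terms [(B^* f)_x f], [B^* f f_x],
    [f_xx f] and [f^2], which all vanish, while the terms of odd order contribute
    nothing in the interior: only the fourth derivative is left, whatever the signs
    of [delta] and [M]. *)
Lemma Rintegral_spatial_op_self (eps L M : R) (f : nat -> R -> R) : 0 <= L ->
  (forall j (x : R), is_derive x 1 (f j) (f j.+1 x)) ->
  f 0%N 0 = 0 -> f 0%N L = 0 ->
  Bstar eps M (f 1%N) (f 2%N) 0 = 0 -> Bstar eps M (f 1%N) (f 2%N) L = 0 ->
  \int[mu]_(x in `]0, L[) (spatial_op eps M f x * f 0%N x) =
    eps * \int[mu]_(x in `]0, L[) (f 2%N x ^+ 2).
Proof.
move=> L0 df f0 fL B0 BL.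
have cf j : continuous (f j) by exact: is_derive_continuous (df j).
have cf2 : continuous (fun x => f 2%N x ^+ 2).
  exact/continuous_sqr/cf.
(* J is a primitive of (P f) f - eps (f_xx)^2 whose boundary values vanish *)
pose J x := eps * (f 3%N x * f 0%N x) - eps * (f 2%N x * f 1%N x) - delta eps M * (f 2%N x * f 0%N x)
  + delta eps M / 2 * f 1%N x ^+ 2 - M / 2 * f 0%N x ^+ 2.
have dJ (x : R) : is_derive x 1 J (spatial_op eps M f x * f 0%N x - eps * f 2%N x ^+ 2).
  rewrite /J; apply: is_derive_eq.
  by rewrite /spatial_op /GRing.scale/=; field.
have cS : continuous (fun x => spatial_op eps M f x * f 0%N x).
  rewrite /spatial_op. continuity_by ltac:(exact: cf).
have := @Rintegral_FTC _ J _ 0 L L0 dJ.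
rewrite RintegralB//; [|exact: integrable_oo|]; last first.
  by apply: integrable_oo; rewrite /spatial_op; continuity_by ltac:(exact: cf).
rewrite RintegralZl//; last exact: integrable_oo.
move=> H; apply/eqP; rewrite -subr_eq0 {}H; last by rewrite /spatial_op; continuity_by ltac:(exact: cf).
rewrite /J f0 fL.
have {}B0 : eps * f 2%N 0 = delta eps M / 2 * f 1%N 0 by apply/eqP; rewrite -subr_eq0; exact/eqP.
have {}BL : eps * f 2%N L = delta eps M / 2 * f 1%N L by apply/eqP; rewrite -subr_eq0; exact/eqP.
by rewrite !(mulrA eps (f 2%N _)) B0 BL; apply/eqP; ring.
Qed.

(** Since [f] vanishes at both ends, [L f_x(0)] is minus the integral of
    [(L - x) f_xx]; the bound is the Cauchy-Schwarz inequality for this integral. *)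
Lemma trace_bound (L : R) (f : nat -> R -> R) : 0 < L ->
  (forall j (x : R), is_derive x 1 (f j) (f j.+1 x)) ->
  f 0%N 0 = 0 -> f 0%N L = 0 ->
  f 1%N 0 ^+ 2 <= L / 3 * \int[mu]_(x in `]0, L[) (f 2%N x ^+ 2).
Proof.
move=> L0 df f0 fL.
have cf j : continuous (f j) by exact: is_derive_continuous (df j).
(* the minimizer of the integral of (f_xx + c (L - x))^2 *)
have [c cE] : exists c, c = 3 * f 1%N 0 / L ^+ 2 by eexists.
pose J x := 2 * c * ((L - x) * f 1%N x + f 0%N x) - c ^+ 2 * ((L - x) * (L - x) * (L - x)) / 3.
have dJ (x : R) : is_derive x 1 J (2 * c * ((L - x) * f 2%N x) + c ^+ 2 * (L - x) ^+ 2).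
  rewrite /J; apply: is_derive_eq.
  by rewrite /GRing.scale/=; field.
have cJ : continuous (fun x => 2 * c * ((L - x) * f 2%N x) + c ^+ 2 * (L - x) ^+ 2).
  by continuity_by ltac:(exact: cf).
have c2 : continuous (fun x => f 2%N x ^+ 2) by exact/continuous_sqr/cf.
have := Rintegral_FTC (ltW L0) dJ cJ.
have : 0 <= \int[mu]_(x in `]0, L[) (f 2%N x + c * (L - x)) ^+ 2.
  by apply: Rintegral_ge0 => x _; exact: sqr_ge0.
rewrite (_ : Rintegral _ _ _ = \int[mu]_(x in `]0, L[) (f 2%N x ^+ 2 + (2 * c * ((L - x) * f 2%N x) + c ^+ 2 * (L - x) ^+ 2))); last first.
  by apply: eq_Rintegral => x _; ring.
rewrite RintegralD//; [|exact: integrable_oo..] => h E; move: h; rewrite {}E /J f0 fL.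
set I := Rintegral _ _ _ => h.
have e : L / 3 * (I + (2 * c * ((L - L) * f 1%N L + 0) - c ^+ 2 * ((L - L) * (L - L) * (L - L)) / 3
    - (2 * c * ((L - 0) * f 1%N 0 + 0) - c ^+ 2 * ((L - 0) * (L - 0) * (L - 0)) / 3))) =
    L / 3 * I - f 1%N 0 ^+ 2.
  by rewrite cE; field; rewrite gt_eqF.
by rewrite -subr_ge0 -e mulr_ge0// divr_ge0// ltW.
Qed.

(** [phi j s x] is the [j]-th space derivative of a solution smooth up to the
    boundary and defined for all times. The time derivative is prescribed along every
    line [x = z + c * s], which gives the chain rule along characteristics without
    a theory of differentiable functions of two variables. Measurability refers to
    the product sigma-algebra; for combinations of modes it is as immediate as
    continuity. *)
Record smooth_adjoint (eps L M : R) (phi : nat -> R -> R -> R) : Prop := {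
  sa_cont : forall j, continuous (fun z : R * R => phi j z.1 z.2);
  sa_meas : forall j, measurable_fun setT (fun z : R * R => phi j z.1 z.2);
  sa_dx : forall s j (x : R), is_derive x 1 (phi j s) (phi j.+1 s x);
  sa_ds : forall (c z s : R), is_derive s 1 (fun r => phi 0%N r (z + c * r))
    (spatial_op eps M (fun j => phi j s) (z + c * s) + c * phi 1%N s (z + c * s));
  sa_0 : forall s, phi 0%N s 0 = 0;
  sa_L : forall s, phi 0%N s L = 0;
  sa_B0 : forall s, Bstar eps M (phi 1%N s) (phi 2%N s) 0 = 0;
  sa_BL : forall s, Bstar eps M (phi 1%N s) (phi 2%N s) L = 0 }.

End smooth.

Arguments sa_cont {R eps L M phi} _ j _ _ _.
Arguments sa_dx {R eps L M phi} _ s j x.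

Section energy.
Context {R : realType}.
Local Notation mu := (@lebesgue_measure R).
Variables (eps L M : R) (phi : nat -> R -> R -> R).
Hypotheses (L0 : 0 < L) (sa : smooth_adjoint eps L M phi).

Lemma sa_contx j s : continuous (phi j s).
Proof. exact: is_derive_continuous (sa_dx sa s j). Qed.

Lemma sa_time (s x : R) :
  is_derive s 1 (fun r => phi 0%N r x) (spatial_op eps M (fun j => phi j s) x).
Proof.
have := sa_ds sa 0 x s; rewrite !mul0r !addr0.
by under eq_fun do rewrite mul0r addr0.
Qed.

Lemma sa_cont_op : continuous (fun z => spatial_op eps M (fun j => phi j z.1) z.2).
Proof. by rewrite /spatial_op; continuity_by ltac:(exact: sa_cont sa _). Qed.

Definition energy s := \int[mu]_(x in `]0, L[) (phi 0%N s x ^+ 2).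
Definition dissipation s := \int[mu]_(x in `]0, L[) (phi 2%N s x ^+ 2).

Lemma continuous_dissipation : continuous dissipation.
Proof.
apply: (continuous_Rintegral1 (F := fun z => phi 2%N z.1 z.2 ^+ 2)).
apply: continuous_sqr; exact: (sa_cont sa 2%N).
Qed.

Lemma is_derive_energy (s : R) : is_derive s 1 energy (2 * eps * dissipation s).
Proof.
apply: is_derive_eq.
  apply: (is_derive_Rintegral1 (F := fun z => phi 0%N z.1 z.2 ^+ 2)
    (F' := fun z => 2 * (spatial_op eps M (fun j => phi j z.1) z.2 * phi 0%N z.1 z.2))).
  - apply: continuous_sqr; exact: (sa_cont sa 0%N).
  - by continuity_by ltac:(first [exact: sa_cont_op | exact: sa_cont sa _]).
  - move=> r x; have h := sa_time r x; apply: is_derive_eq.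
    by rewrite /GRing.scale/=; ring.
rewrite RintegralZl//; last first.
  apply: integrable_oo.
  have := continuous_sliceR s sa_cont_op => /= c1.
  by continuity_by ltac:(first [exact: c1 | exact: sa_contx]).
have e := @Rintegral_spatial_op_self R eps L M (fun j => phi j s) (ltW L0) (sa_dx sa s)
  (sa_0 sa s) (sa_L sa s) (sa_B0 sa s) (sa_BL sa s).
by rewrite -mulrA; congr (2 * _).
Qed.

(** Backward in time the energy is dissipated, hence it grows with [s]; its growth
    controls the second derivative. *)
Lemma energy_balance s0 s1 : s0 <= s1 ->
  energy s1 - energy s0 = 2 * eps * \int[mu]_(s in `]s0, s1[) dissipation s.
Proof.
move=> s01; rewrite -(Rintegral_FTC s01 is_derive_energy); last first.
  by continuity_by ltac:(exact: continuous_dissipation).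
by rewrite RintegralZl//; apply: integrable_oo; exact: continuous_dissipation.
Qed.

(** This is where the observation [phi_x(., 0)] enters: it is paid for by the growth
    of the energy over the time interval, divided by [eps]. *)
Lemma trace_energy_bound s0 s1 : 0 < eps -> s0 <= s1 ->
  \int[mu]_(s in `]s0, s1[) (phi 1%N s 0 ^+ 2) <=
    L / (6 * eps) * (energy s1 - energy s0).
Proof.
move=> e0 s01; rewrite energy_balance//.
rewrite (_ : _ * (_ * _) = L / 3 * \int[mu]_(s in `]s0, s1[) dissipation s); last first.
  by field; rewrite gt_eqF.
rewrite -RintegralZl//; last by apply: integrable_oo; exact: continuous_dissipation.
apply: le_Rintegral => //.
- apply: integrable_oo; apply: continuous_sqr.
  exact: (continuous_sliceL 0 (sa_cont sa 1%N)).
- by apply: integrable_oo; continuity_by ltac:(exact: continuous_dissipation).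
- move=> s _; exact: (@trace_bound R L (fun j => phi j s) L0 (sa_dx sa s) (sa_0 sa s) (sa_L sa s)).
Qed.

End energy.

(** * Comparison with a transported profile *)

Section transport.
Context {R : realType}.
Local Notation mu := (@lebesgue_measure R).

Lemma Rintegral_shift (f : R -> R) (c a b : R) : a <= b -> continuous f ->
  \int[mu]_(z in `]a, b[) f (z + c) = \int[mu]_(x in `]a + c, b + c[) f x.
Proof.
move=> ab cf.
have dF (x : R) : is_derive x 1 (fun z : R => z + c) 1.
  by apply: is_derive_eq; rewrite addr0.
have dF1 : derive1 (fun z : R => z + c) = cst 1.
  by apply/funext => x; rewrite derive1E; exact: derive_val.
have cF := is_derive_continuous dF.
have cfc : continuous (fun z => f (z + c)).
  by move=> z; apply: (@continuous_comp _ _ _ (fun z => z + c) f); [exact: cF|exact: cf].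
rewrite !Rintegral_oo_cc; [|exact: integrable_oo..].
rewrite /Rintegral (@integration_by_substitution_increasing _ (fun z => z + c) f a b ab).
- by rewrite dF1; congr fine; apply: eq_integral => x _; rewrite /= !fctE mulr1.
- by move=> x y _ _ xy; rewrite ltrD2r.
- by rewrite dF1 => x _; exact: cst_continuous.
- by rewrite dF1; exact: is_cvg_cst.
- by rewrite dF1; exact: is_cvg_cst.
- split; first by move=> x _; have [] := dF x.
  + exact/cvg_at_right_filter/cF.
  + exact/cvg_at_left_filter/cF.
- exact: continuous_subspaceT.
Qed.

Lemma le_Rintegral_subset (f : R -> R) (a b c d : R) : continuous f ->
  (forall x, 0 <= f x) -> c <= a -> b <= d ->
  \int[mu]_(x in `]a, b[) f x <= \int[mu]_(x in `]c, d[) f x.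
Proof.
move=> cf f0 ca bd; rewrite [leLHS]Rintegral_mkcond [leRHS]Rintegral_mkcond.
have mi (u v : R) : mu.-integrable setT (EFin \o (f \_ `]u, v[)).
  by rewrite -restrict_EFin; apply/integrable_restrict => //; rewrite setTI; exact: integrable_oo.
apply: le_Rintegral => // x _; rewrite !patchE.
case: ifPn => [xab|_]; last by case: ifP.
rewrite ifT// inE/=; move: xab; rewrite inE/= !in_itv/= => /andP[h1 h2].
by rewrite (le_lt_trans ca h1) (lt_le_trans h2 bd).
Qed.

Lemma Rintegral_lin3 (f g h : R -> R) (k a b : R) : continuous f -> continuous g -> continuous h ->
  \int[mu]_(x in `]a, b[) (f x + k * g x + h x) = \int[mu]_(x in `]a, b[) f x +
    k * \int[mu]_(x in `]a, b[) g x + \int[mu]_(x in `]a, b[) h x.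
Proof.
move=> cf cg ch.
have ckg : continuous (fun x => k * g x) by continuity_by idtac.
rewrite RintegralD//; [|apply: integrable_oo; by continuity_by idtac|exact: integrable_oo].
rewrite RintegralD//; [|exact: integrable_oo..].
by rewrite RintegralZl//; exact: integrable_oo.
Qed.

(** All boundary terms contain a derivative of [p] of order at most three. *)
Lemma Rintegral_transport_adjoint (eps M a b : R) (f p : nat -> R -> R) : a <= b ->
  (forall j (x : R), is_derive x 1 (f j) (f j.+1 x)) ->
  (forall j (x : R), is_derive x 1 (p j) (p j.+1 x)) ->
  (forall j, (j < 4)%N -> p j a = 0 /\ p j b = 0) ->
  \int[mu]_(z in `]a, b[) ((eps * f 4%N z - delta eps M * f 3%N z) * p 0%N z) =
  \int[mu]_(z in `]a, b[) (f 0%N z * (eps * p 4%N z + delta eps M * p 3%N z)).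
Proof.
move=> ab df dp pab.
have cf j : continuous (f j) by exact: is_derive_continuous (df j).
have cp j : continuous (p j) by exact: is_derive_continuous (dp j).
pose J1 x := eps * (f 3%N x * p 0%N x - f 2%N x * p 1%N x + f 1%N x * p 2%N x - f 0%N x * p 3%N x).
pose J2 x := delta eps M * (f 2%N x * p 0%N x - f 1%N x * p 1%N x + f 0%N x * p 2%N x).
pose F x := (eps * f 4%N x - delta eps M * f 3%N x) * p 0%N x
    - f 0%N x * (eps * p 4%N x + delta eps M * p 3%N x).
have dJ1 (x : R) : is_derive x 1 J1 (eps * (f 4%N x * p 0%N x - f 0%N x * p 4%N x)).
  by rewrite /J1; apply: is_derive_eq; rewrite /GRing.scale/=; ring.
have dJ2 (x : R) : is_derive x 1 J2 (delta eps M * (f 3%N x * p 0%N x + f 0%N x * p 3%N x)).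
  by rewrite /J2; apply: is_derive_eq; rewrite /GRing.scale/=; ring.
have dJ (x : R) : is_derive x 1 (fun x => J1 x - J2 x) (F x).
  by apply: is_derive_eq; rewrite /F; ring.
have c1 : continuous (fun z => (eps * f 4%N z - delta eps M * f 3%N z) * p 0%N z).
  by continuity_by ltac:(first [exact: cf | exact: cp]).
have c2 : continuous (fun z => f 0%N z * (eps * p 4%N z + delta eps M * p 3%N z)).
  by continuity_by ltac:(first [exact: cf | exact: cp]).
have := Rintegral_FTC ab dJ (continuous_add c1 (continuous_opp c2)).
rewrite RintegralB//; [|exact: integrable_oo..] => E.
apply/eqP; rewrite -subr_eq0 E /J1 /J2.
have [-> ->] := pab 0%N isT. have [-> ->] := pab 1%N isT.
have [-> ->] := pab 2%N isT. have [-> ->] := pab 3%N isT.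
by apply/eqP; ring.
Qed.

End transport.

Section estimate.
Context {R : realType}.
Local Notation mu := (@lebesgue_measure R).
Variables (eps L M T : R) (phi : nat -> R -> R -> R).
Hypotheses (eps0 : 0 < eps) (L0 : 0 < L) (T0 : 0 <= T).
Hypothesis sa : smooth_adjoint eps L M phi.
Variables (a b : R) (p : nat -> R -> R).
Hypothesis dp : forall j (x : R), is_derive x 1 (p j) (p j.+1 x).
Hypothesis pab : forall j, (j < 4)%N -> p j a = 0 /\ p j b = 0.
Hypotheses (ab : a <= b) (a0 : 0 <= a) (aT0 : 0 <= a - M * T)
  (bL : b <= L) (bTL : b - M * T <= L).

Let cp j : continuous (p j). Proof. exact: is_derive_continuous (dp j). Qed.

Let c_line2 j : continuous (fun z => phi j z.1 (z.2 - M * T + M * z.1)).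
Proof. exact: (continuous_line (F := fun z => phi j z.1 z.2) (M * T) M (sa_cont sa j)). Qed.

Let c_line j s : continuous (fun z => phi j s (z - M * T + M * s)).
Proof. exact: (@continuous_sliceR _ (fun z => phi j z.1 (z.2 - M * T + M * z.1)) s (@c_line2 j)). Qed.

(** The scalar product of [phi s] with the profile [p] transported at speed [M] and
    placed on [(a, b)] at time [T], written in the moving frame. *)
Definition pairing s := \int[mu]_(z in `]a, b[) (phi 0%N s (z - M * T + M * s) * p 0%N z).

(** The derivative of [pairing]: what is left of the equation once the transport
    terms [phi_s] and [M phi_x] have cancelled; it carries a factor [eps] or [delta]. *)
Definition transport_defect s := \int[mu]_(z in `]a, b[)
  (phi 0%N s (z - M * T + M * s) * (eps * p 4%N z + delta eps M * p 3%N z)).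

Lemma continuous_transport_defect : continuous transport_defect.
Proof.
apply: (continuous_Rintegral (F := fun z => phi 0%N z.1 (z.2 - M * T + M * z.1))).
  exact: c_line2.
by apply: integrable_oo; continuity_by ltac:(exact: cp).
Qed.

(** Along the characteristics [phi_s + M phi_x = eps phi_xxxx - delta phi_xxx], and
    the right-hand side is integrated by parts onto the profile. *)
Lemma is_derive_pairing (s : R) : is_derive s 1 pairing (transport_defect s).
Proof.
have c4 := sa_cont sa 4%N. have c3 := sa_cont sa 3%N.
have c43 : continuous (fun z : R * R => eps * phi 4%N z.1 z.2 - delta eps M * phi 3%N z.1 z.2).
  by continuity_by idtac.
apply: is_derive_eq.
  apply: (is_derive_Rintegral (F := fun z => phi 0%N z.1 (z.2 - M * T + M * z.1))
    (F' := fun z => eps * phi 4%N z.1 (z.2 - M * T + M * z.1)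
           - delta eps M * phi 3%N z.1 (z.2 - M * T + M * z.1))).
  - exact: c_line2.
  - exact: (continuous_line (M * T) M c43).
  - move=> r x; apply: is_derive_eq (sa_ds sa M (x - M * T) r) _.
    by rewrite /spatial_op; ring.
  - by apply: integrable_oo; exact: cp.
apply: (@Rintegral_transport_adjoint _ _ _ _ _ (fun j z => phi j s (z - M * T + M * s)) p) => //.
move=> j x; have dl : is_derive x 1 (fun z : R => z - M * T + M * s) 1.
  by apply: is_derive_eq; rewrite subr0 addr0.
by have := is_derive_comp dl (sa_dx sa s j (x - M * T + M * s)); rewrite mulr1.
Qed.

(** The support of the transported profile stays inside [(0, L)]. *)
Lemma line_energy_le (s : R) : 0 <= s <= T ->
  \int[mu]_(z in `]a, b[) (phi 0%N s (z - M * T + M * s) ^+ 2) <= energy L phi s.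
Proof.
move=> /andP[s0 sT].
rewrite (@eq_Rintegral _ _ R mu _ (fun z => phi 0%N s (z + (M * s - M * T)) ^+ 2)); last first.
  by move=> z _; have -> : z + (M * s - M * T) = z - M * T + M * s by ring.
have c2 : continuous (fun x => phi 0%N s x ^+ 2) by apply: continuous_sqr; exact: (sa_contx sa).
rewrite (Rintegral_shift (f := fun x => phi 0%N s x ^+ 2))//.
apply: le_Rintegral_subset => //; first by move=> x; exact: sqr_ge0.
(* the interval moves monotonically, so it is inside at time s if it is at 0 and T *)
- have [M0|/ltW M0] := leP 0 M.
    by rewrite addrCA addr_ge0// mulr_ge0.
  by rewrite addr_ge0// subr_ge0 ler_wnM2l.
- have [M0|/ltW M0] := leP 0 M.
    by rewrite (le_trans _ bL)// gerDl subr_le0 ler_wpM2l.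
  by rewrite addrCA (le_trans _ bTL)// gerDr mulr_le0_ge0.
Qed.

(** Nonnegativity of the squared distance between [phi s] and [k] times the
    transported profile. *)
Lemma energy_pairing_ge0 (k s : R) : 0 <= s <= T ->
  0 <= energy L phi s - 2 * k * pairing s
       + k ^+ 2 * \int[mu]_(z in `]a, b[) (p 0%N z ^+ 2).
Proof.
move=> sT; have cl := @c_line 0%N s; have cp0 := @cp 0%N.
have : 0 <= \int[mu]_(z in `]a, b[) (phi 0%N s (z - M * T + M * s) - k * p 0%N z) ^+ 2.
  by apply: Rintegral_ge0 => x _; exact: sqr_ge0.
rewrite (@eq_Rintegral _ _ R mu _ (fun z => phi 0%N s (z - M * T + M * s) ^+ 2
  + (- (2 * k)) * (phi 0%N s (z - M * T + M * s) * p 0%N z) + k ^+ 2 * p 0%N z ^+ 2));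
  last by move=> z _; ring.
rewrite Rintegral_lin3; [|by continuity_by idtac..].
rewrite RintegralZl//; last by apply: integrable_oo; continuity_by idtac.
move/le_trans; apply; rewrite mulNr lerD2r lerD2r; exact: line_energy_le.
Qed.

Lemma le_energy (s0 s1 : R) : s0 <= s1 -> energy L phi s0 <= energy L phi s1.
Proof.
move=> s01; rewrite -subr_ge0 (energy_balance L0 sa)//.
rewrite mulr_ge0//; first by rewrite mulr_ge0// ltW.
by apply: Rintegral_ge0 => s _; apply: Rintegral_ge0 => x _; exact: sqr_ge0.
Qed.

(** The integrand is split by Young's inequality, so that only the energy and a fixed
    integral of the profile appear; the energy at [s] is at most the one at [T]. *)
Lemma transport_defect_bound (k m s : R) : 0 <= k -> eps <= k ->
  `|delta eps M| <= m * k -> 0 <= s <= T ->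
  `|transport_defect s| <= k / 2 * (energy L phi T +
     \int[mu]_(z in `]a, b[) (2 * p 4%N z ^+ 2 + 2 * m ^+ 2 * p 3%N z ^+ 2)).
Proof.
move=> k0 ek dk sT; have cl := @c_line 0%N s; have cp4 := @cp 4%N; have cp3 := @cp 3%N.
have ccons : continuous (fun z => phi 0%N s (z - M * T + M * s) *
    (eps * p 4%N z + delta eps M * p 3%N z)) by continuity_by idtac.
have cq : continuous (fun z => 2 * p 4%N z ^+ 2 + 2 * m ^+ 2 * p 3%N z ^+ 2).
  by continuity_by idtac.
have cl2 := continuous_sqr cl.
apply: (le_trans (le_normr_Rintegral _ _)) => //; first exact: integrable_oo.
apply: (@le_trans _ _ (\int[mu]_(z in `]a, b[) (k / 2 * (phi 0%N s (z - M * T + M * s) ^+ 2 +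
   (2 * p 4%N z ^+ 2 + 2 * m ^+ 2 * p 3%N z ^+ 2))))).
  apply: le_Rintegral => //.
  - exact/integrable_norm/integrable_oo.
  - by apply: integrable_oo; continuity_by idtac.
  move=> z _; rewrite normrM.
  set u := phi 0%N s _; set v := p 4%N z; set w := p 3%N z.
  have h : `|eps * v + delta eps M * w| <= k * (`|v| + m * `|w|).
    move: (delta eps M) dk => d dk; rewrite (le_trans (ler_normD _ _))// !normrM.
    rewrite (ger0_norm (ltW eps0)) mulrDr.
    apply: lerD; first by rewrite ler_wpM2r.
    rewrite (_ : k * (m * `|w|) = m * k * `|w|); last by ring.
    exact: ler_wpM2r.
  apply: (le_trans (ler_wpM2l (normr_ge0 _) h)); clear h.
  rewrite -(real_normK (num_real u)) -(real_normK (num_real v)) -(real_normK (num_real w)).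
  move: `|u| `|v| `|w| => {}u {}v {}w.
  (* u (v + m w) <= (u^2 + 2 v^2 + 2 m^2 w^2) / 2 *)
  rewrite -subr_ge0 (_ : _ - _ = k / 2 * ((u - (v + m * w)) ^+ 2 + (v - m * w) ^+ 2)); last by field.
  by rewrite mulr_ge0 ?divr_ge0 ?addr_ge0 ?sqr_ge0.
rewrite RintegralZl//; last by apply: integrable_oo; exact: continuous_add.
rewrite RintegralD//; [|exact: integrable_oo..].
rewrite ler_wpM2l ?divr_ge0// lerD2r (le_trans (line_energy_le sT))//.
by apply: le_energy; case/andP: sT.
Qed.

Lemma pairing_variation (k m : R) : 0 <= k -> eps <= k -> `|delta eps M| <= m * k ->
  `|pairing T - pairing 0| <= T * (k / 2 * (energy L phi T +
     \int[mu]_(z in `]a, b[) (2 * p 4%N z ^+ 2 + 2 * m ^+ 2 * p 3%N z ^+ 2))).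
Proof.
move=> k0 ek dk; set C := k / 2 * _.
rewrite -(Rintegral_FTC T0 is_derive_pairing continuous_transport_defect).
apply: (le_trans (le_normr_Rintegral _ _)) => //.
  by apply: integrable_oo; exact: continuous_transport_defect.
have cC : continuous (fun _ : R => C) by exact: cst_continuous.
rewrite (_ : T * C = \int[mu]_(s in `]0, T[) C); last first.
  have dC (x : R) : is_derive x 1 (fun s : R => C * s) C.
    by apply: is_derive_eq; rewrite /GRing.scale/= mulr1.
  by rewrite (Rintegral_FTC T0 dC cC); ring.
apply: le_Rintegral => //; first by apply/integrable_norm/integrable_oo; exact: continuous_transport_defect.
  exact: integrable_oo.
by move=> s /=; rewrite in_itv/= => /andP[s0 sT]; apply: transport_defect_bound => //; rewrite (ltW s0) (ltW sT).
Qed.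

(** If [phi T] is close to the profile then the energy at time [T] is almost
    [2 * pairing T - G], while at time [0] it is at least [2 * pairing 0 - G]; as the
    pairing is almost conserved, the energy can only grow by [O(k)], and so does
    [eps] times the squared trace. Here [k] is the size of [eps] and [delta]. *)
Lemma trace_pairing_bounds (k m : R) :
  let G := \int[mu]_(z in `]a, b[) (p 0%N z ^+ 2) in
  let C := \int[mu]_(z in `]a, b[) (2 * p 4%N z ^+ 2 + 2 * m ^+ 2 * p 3%N z ^+ 2) in
  let K := 1 + T * (2 + 2 * G + C) in
  k <= 1 -> eps <= k -> `|delta eps M| <= m * k ->
  energy L phi T - 2 * pairing T + G <= k ->
  \int[mu]_(s in `]0, T[) (phi 1%N s 0 ^+ 2) <= L / (6 * eps) * (k * K) /\
  (G - k - k * K) / 2 <= pairing 0.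
Proof.
move=> G C K k1 ek dk Hk.
have k0 : 0 < k by exact: lt_le_trans ek.
have TT : 0 <= T <= T by rewrite T0 lexx.
have T00 : (0 : R) <= 0 <= T by rewrite T0 lexx.
have := energy_pairing_ge0 2 TT; have := energy_pairing_ge0 1 T00.
have := pairing_variation (ltW k0) ek dk.
rewrite -/G -/C ler_norml => /andP[v1 v2] e0 eT.
have eTle : energy L phi T <= 2 + 2 * G by nra.
have ET0 : 0 <= energy L phi T by apply: Rintegral_ge0 => x _; exact: sqr_ge0.
have w : T * (k / 2 * (energy L phi T + C)) <= k / 2 * (K - 1).
  have -> : K - 1 = T * (2 + 2 * G + C) by rewrite /K; ring.
  rewrite mulrCA ler_wpM2l ?divr_ge0 ?(ltW k0)// ler_wpM2l// lerD2r.
  exact: eTle.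
split.
  apply: (le_trans (trace_energy_bound L0 sa eps0 T0)).
  apply: ler_wpM2l; first by rewrite divr_ge0 ?mulr_ge0 ?ltW.
  nra.
nra.
Qed.

End estimate.

(** * Square integrable functions *)

Section L2tools.
Context {d : measure_display} {T : measurableType d} {R : realType}.
Variable mu : {measure set T -> \bar R}.

Lemma EFin_Rintegral (D : set T) (f : T -> R) : measurable D ->
  mu.-integrable D (EFin \o f) ->
  (\int[mu]_(x in D) (f x)%:E)%E = (\int[mu]_(x in D) f x)%:E.
Proof. by move=> mD intf; rewrite /Rintegral fineK//; exact: integrable_fin_num. Qed.

Lemma L2norm_sqrt (D : set T) (f : T -> R) : measurable D ->
  mu.-integrable D (EFin \o (fun x => f x ^+ 2)) ->
  L2norm mu D f = (Num.sqrt (\int[mu]_(x in D) (f x ^+ 2)))%:E.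
Proof.
move=> mD intf; rewrite /L2norm unlock /=.
rewrite (_ : (\int[mu]_x _)%E = (\int[mu]_(x in D) (f x ^+ 2)%:E)%E); last first.
  rewrite [RHS]integral_mkcond; apply: eq_integral => x _.
  rewrite /= !patchE; case: ifPn => _ /=.
    by rewrite powR_mulrn// real_normK// num_real.
  by rewrite normr0 powR0.
rewrite EFin_Rintegral//= powR12_sqrt//.
by apply: Rintegral_ge0 => x _; exact: sqr_ge0.
Qed.

Lemma L2on_sqr_integrable (D : set T) (f : T -> R) : measurable D ->
  measurable_fun D f -> mu.-integrable D (EFin \o (fun x => f x ^+ 2)) ->
  L2on mu D f.
Proof.
move=> mD mf intf; rewrite /L2on; apply/andP; split; rewrite inE/=.
  exact: (measurable_restrictT f mD).1.
by rewrite /finite_norm; have := L2norm_sqrt mD intf; rewrite /L2norm => ->; rewrite ltry.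
Qed.

Lemma L2on_integrable_sqr (D : set T) (f : T -> R) : measurable D ->
  L2on mu D f -> mu.-integrable D (EFin \o (fun x => f x ^+ 2)).
Proof.
move=> mD /Lfun2_integrable_sqr => h.
apply/integrable_mkcond => //; apply: eq_integrable h => // x _.
by rewrite /= !patchE; case: ifPn => //= _; rewrite expr0n.
Qed.

Lemma L2on_measurable (D : set T) (f : T -> R) : measurable D ->
  L2on mu D f -> measurable_fun D f.
Proof.
by move=> mD /andP[/[1!inE]/= mf _]; exact/(measurable_restrictT f mD).
Qed.

End L2tools.

Section L2_interval.
Context {R : realType}.
Local Notation mu := (@lebesgue_measure R).

Lemma L2on_continuous (f : R -> R) (a b : R) : continuous f -> L2on mu `]a, b[ f.
Proof.
move=> cf; apply: L2on_sqr_integrable => //.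
  by apply: measurable_funTS; exact: continuous_measurable_fun.
exact/integrable_oo/continuous_sqr.
Qed.

Lemma L2on_integrable (f : R -> R) (a b : R) : L2on mu `]a, b[ f ->
  mu.-integrable `]a, b[ (EFin \o f).
Proof.
move=> L2f; have mI : measurable (`]a, b[ : set (measurableTypeR R)) by [].
have mf := L2on_measurable mI L2f.
have i2 := L2on_integrable_sqr mI L2f.
have i1 : mu.-integrable `]a, b[ (EFin \o (fun=> 1 : R)).
  by apply: integrable_oo; exact: cst_continuous.
have := @integrableD _ _ R mu _ mI _ _ i1 i2.
apply: le_integrable => //; first exact/measurable_EFinP.
move=> x _; rewrite /= lee_fin [leRHS]ger0_norm ?addr_ge0 ?sqr_ge0//.
have := sqr_ge0 (`|f x| - 1); have := normr_ge0 (f x).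
rewrite -(real_normK (num_real (f x))); move: `|f x| => u; nra.
Qed.

Lemma L2on_rectangle (F : R * R -> R) (a b c d : R) :
  continuous F -> measurable_fun setT F ->
  L2on (mu \x mu)%E (`]a, b[ `*` `]c, d[) F.
Proof.
move=> cF mF.
have [C C0 hC] := bounded_rectangle a b c d cF.
have mD : measurable (`]a, b[ `*` `]c, d[ : set (measurableTypeR R * measurableTypeR R)).
  exact: measurableX.
apply: L2on_sqr_integrable => //; first exact: measurable_funTS.
apply: measurable_bounded_integrable => //.
- rewrite /= product_measure1E//= !lebesgue_measure_itv/= !lte_fin.
  by do 2 case: ifP => _; rewrite ?mule0 ?mul0e ?ltry// -!EFinB -EFinM ltry.
- by apply: measurable_funTS; exact: measurable_funX.
- exists (C ^+ 2); split; first exact: num_real.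
  move=> r Cr [s x] [/= sI xI]; rewrite (le_trans _ (ltW Cr))// normrX.
  rewrite ler_sqr ?nnegrE//; apply: hC; exact: subset_itv_oo_cc.
Qed.

End L2_interval.

(** * Integration by parts for absolutely continuous functions *)

Section absolutely_continuous.
Context {R : realType}.
Local Notation mu := (@lebesgue_measure R).
Variables (L : R) (q G g : R -> R).
Hypothesis (iq : mu.-integrable `]0, L[ (EFin \o q)).
Hypotheses (dG : forall x : R, is_derive x 1 G (g x)) (cg : continuous g).

Let gI := g \_ `]0, L[.
Let qI := q \_ `]0, L[.
Let h (z : R * R) : R := gI z.1 * qI z.2 * (z.2 < z.1)%R%:R.

Let igI : mu.-integrable setT (EFin \o gI).
Proof.
by rewrite -restrict_EFin; apply/integrable_restrict => //; rewrite setTI; exact: integrable_oo.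
Qed.

Let iqI : mu.-integrable setT (EFin \o qI).
Proof. by rewrite -restrict_EFin; apply/integrable_restrict => //; rewrite setTI. Qed.

Let mh : measurable_fun setT h.
Proof.
have m1 : measurable_fun setT gI by apply/measurable_EFinP; case/integrableP: igI.
have m2 : measurable_fun setT qI by apply/measurable_EFinP; case/integrableP: iqI.
apply: measurable_funM; first by apply: measurable_funM; exact: measurableT_comp.
rewrite (_ : (fun _ => _) = (fun b : bool => b%:R) \o (fun z : R * R => z.2 < z.1))//.
apply: measurableT_comp => //.
exact: measurable_fun_ltr.
Qed.

Let ih : ((mu \x mu)%E).-integrable setT (EFin \o h).
Proof.
have mg : measurable_fun setT gI by apply/measurable_EFinP; case/integrableP: igI.
have mq : measurable_fun setT qI by apply/measurable_EFinP; case/integrableP: iqI.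
have [_ gfin] := integrableP _ _ _ igI; have [_ qfin] := integrableP _ _ _ iqI.
apply/integrable12ltyP; first exact/measurable_EFinP.
apply: (@le_lt_trans _ _ ((\int[mu]_y `|(qI y)%:E|) * \int[mu]_x `|(gI x)%:E|)%E).
  rewrite -ge0_integralZl//; [|by do 2 apply: measurableT_comp => //|exact: integral_ge0].
  apply: ge0_le_integral => //.
  - by move=> x _; exact: integral_ge0.
  - apply: (@measurable_fun_fubini_tonelli_F _ _ _ _ R mu (abse \o (EFin \o h))) => //.
      by apply: measurableT_comp => //; exact/measurable_EFinP.
    by move=> z; exact: abse_ge0.
  - by apply: measurable_funeM; do 2 apply: measurableT_comp => //.
  - move=> x _; rewrite muleC -ge0_integralZl//; last by do 2 apply: measurableT_comp => //.
    apply: ge0_le_integral => //.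
    + apply: measurableT_comp => //; apply/measurable_EFinP.
      by apply: (@measurable_fun_pair2 _ _ _ _ _ _ h).
    + by apply: measurable_funeM; do 2 apply: measurableT_comp => //.
    + move=> y _; rewrite /= -EFinM lee_fin /h/= !normrM -[leRHS]mulr1 ler_wpM2l//.
      by case: (_ < _)%R; rewrite ?normr1// normr0.
have q0 : (0 <= \int[mu]_y `|(qI y)%:E|)%E by exact: integral_ge0.
by apply: lte_mul_pinfty => //; rewrite ge0_fin_numE.
Qed.

Let integrable_sub (x : R) : x \in `]0, L[ -> mu.-integrable `]0, x[ (EFin \o q).
Proof.
rewrite in_itv/= => /andP[x0 xL]; apply: (integrableS _ _ _ iq) => //.
by apply: subset_itvl; rewrite bnd_simp ltW.
Qed.

(** Fubini's theorem for [g x * q z] on the triangle [z < x]. *)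
Lemma Rintegral_swap :
  \int[mu]_(x in `]0, L[) (g x * \int[mu]_(z in `]0, x[) q z) =
  \int[mu]_(z in `]0, L[) ((G L - G z) * q z).
Proof.
have E := Fubini ih.
transitivity (fine (\int[mu]_x \int[mu]_y (EFin \o h) (x, y))%E).
  rewrite /Rintegral integral_mkcond; congr fine; apply: eq_integral => x _.
  rewrite patchE; case: ifPn => [|xI]; last first.
    rewrite integral0_eq// => y _; rewrite /= /h/= /gI patchE (negbTE xI).
    by rewrite !mul0r.
  rewrite inE/= => xI; rewrite [RHS](_ : _ = \int[mu]_(y in `]0%R, x[) ((g x)%:E * (q y)%:E))%E.
    rewrite integralZl//; last exact: integrable_sub.
    by rewrite EFin_Rintegral//; exact: integrable_sub.
  rewrite [RHS]integral_mkcond; apply: eq_integral => y _.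
  rewrite /= /h/= /gI /qI !patchE mem_set//.
  move: xI; rewrite in_itv/= => /andP[x0 xL].
  have [yx|yx] := boolP (y \in `]0, x[%classic).
    move: (yx); rewrite inE/= in_itv/= => /andP[y0 yx'].
    by rewrite mem_set/= ?in_itv/= ?y0 ?(lt_trans yx' xL)// yx' mulr1 EFinM.
  case: ifPn => [|_]; last by rewrite mulr0 mul0r.
  rewrite inE/= in_itv/= => /andP[y0 yL]; move: yx.
  by rewrite notin_setE/= in_itv/= y0/= => /negP/negbTE ->; rewrite mulr0.
rewrite E /Rintegral [in RHS]integral_mkcond; congr fine; apply: eq_integral => y _.
rewrite [RHS]patchE; case: ifPn => [|yI]; last first.
  by rewrite integral0_eq// => x _; rewrite /= /h/= /qI patchE (negbTE yI) mulr0 mul0r.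
rewrite inE/= => yI; have := yI; rewrite in_itv/= => /andP[y0 yL].
rewrite -(Rintegral_FTC (ltW yL) dG cg) mulrC EFinM.
rewrite -EFin_Rintegral//; last exact: integrable_oo.
rewrite -integralZl//; last exact: integrable_oo.
rewrite [RHS]integral_mkcond; apply: eq_integral => x _.
rewrite /= /h/= /gI /qI !patchE [y \in _]mem_set//.
have [xy|xy] := boolP (x \in `]y, L[%classic).
  move: (xy); rewrite inE/= in_itv/= => /andP[yx xL].
  by rewrite mem_set/= ?in_itv/= ?xL ?(lt_trans y0 yx)// yx mulr1 mulrC EFinM.
case: ifPn => [|_]; last by rewrite !mul0r.
rewrite inE/= in_itv/= => /andP[x0 xL]; move: xy.
by rewrite notin_setE/= in_itv/= xL andbT => /negP/negbTE ->; rewrite mulr0.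
Qed.

End absolutely_continuous.

Section AC.
Context {R : realType}.
Local Notation mu := (@lebesgue_measure R).

(** [F] is absolutely continuous on [[0, L]] with derivative [F1]. *)
Definition primitive_on (L : R) (F F1 : R -> R) :=
  mu.-integrable `]0, L[ (EFin \o F1) /\
  forall x, x \in `[0, L] -> F x = F 0 + \int[mu]_(z in `[0, x]) F1 z.

Lemma integrable_oo_cc (f : R -> R) (a b : R) : mu.-integrable `]a, b[ (EFin \o f) ->
  mu.-integrable `[a, b] (EFin \o f).
Proof.
move=> /integrableP[/measurable_EFinP mf fi].
have mf' : measurable_fun `[a, b] f.
  apply/measurable_fun_itv_obnd_cbndP.
  by apply/measurable_fun_itv_bndo_bndcP.
apply/integrableP; split; first exact/measurable_EFinP.
by rewrite integral_itv_bndoo//; do 2 apply: measurableT_comp => //.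
Qed.

Lemma primitive_on_oo (L : R) (F F1 : R -> R) : primitive_on L F F1 ->
  forall x, x \in `[0, L] -> \int[mu]_(z in `]0, x[) F1 z = F x - F 0.
Proof.
move=> [i1 FE] x xL; rewrite FE// (addrC (F 0)) addrK Rintegral_oo_cc//.
apply: (integrableS _ _ _ i1) => //; apply: subset_itvl; rewrite bnd_simp.
by move: xL; rewrite in_itv/= => /andP[].
Qed.

Lemma primitive_on_integrable (L : R) (F F1 : R -> R) : 0 <= L -> primitive_on L F F1 ->
  mu.-integrable `]0, L[ (EFin \o F).
Proof.
move=> L0 [i1 FE]; have i1' := integrable_oo_cc i1.
have cF := parameterized_integral_continuous L0 i1'.
have iP := continuous_compact_integrable (@segment_compact R 0 L) cF.
have iP' : mu.-integrable `]0, L[ (EFin \o (fun x => F 0 + \int[mu]_(z in `[0, x]) F1 z)).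
  have ic : mu.-integrable `]0, L[ (EFin \o (fun=> F 0)).
    by apply: integrable_oo; exact: cst_continuous.
  have iP2 : mu.-integrable `]0, L[ (EFin \o (fun x => \int[mu]_(z in `[0, x]) F1 z)).
    by apply: (integrableS _ _ _ iP) => //; exact: subset_itv_oo_cc.
  exact: (integrableD _ ic iP2).
apply: eq_integrable iP' => // x; rewrite inE/= => xI.
have xI' : x \in `[0, L] by exact: subset_itv_oo_cc.
by rewrite (FE _ xI').
Qed.

(** One factor is only absolutely continuous, as are the test functions of the weak
    formulation; the other one is smooth. *)
Lemma integration_by_parts_AC (L : R) (F F1 G g : R -> R) : 0 <= L ->
  primitive_on L F F1 ->
  (forall x : R, is_derive x 1 G (g x)) -> continuous g ->
  \int[mu]_(x in `]0, L[) (G x * F1 x) =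
    G L * F L - G 0 * F 0 - \int[mu]_(x in `]0, L[) (g x * F x).
Proof.
move=> L0 pF dG cg; have iF := primitive_on_integrable L0 pF.
have [i1 _] := pF; have FE := primitive_on_oo pF.
have cG := is_derive_continuous dG.
have := Rintegral_swap i1 dG cg.
have -> : \int[mu]_(x in `]0, L[) (g x * \int[mu]_(z in `]0, x[) F1 z) =
    \int[mu]_(x in `]0, L[) (g x * F x - F 0 * g x).
  apply: eq_Rintegral => x; rewrite inE/= => xI; rewrite FE; first by ring.
  exact: subset_itv_oo_cc.
have -> : \int[mu]_(z in `]0, L[) ((G L - G z) * F1 z) =
    \int[mu]_(z in `]0, L[) (G L * F1 z - G z * F1 z).
  by apply: eq_Rintegral => x _; ring.
have cFg : continuous (fun x => F 0 * g x) by continuity_by idtac.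
have cGL : continuous (fun _ : R => G L) by exact: cst_continuous.
rewrite RintegralB//; [|exact: integrable_mul_bounded|exact: integrable_oo].
rewrite RintegralB//; [|exact: (integrable_mul_bounded i1 cGL)|exact: integrable_mul_bounded].
rewrite !RintegralZl//; last exact: integrable_oo.
rewrite (Rintegral_FTC L0 dG cg) FE; last by rewrite in_itv/= L0 lexx.
lra.
Qed.

Lemma H2_primitive_on (L : R) (psi psi1 psi2 : R -> R) : 0 <= L -> H2 L psi psi1 psi2 ->
  primitive_on L psi psi1 /\ primitive_on L psi1 psi2.
Proof.
move=> L0 [h2 e1 e0].
have p1 : primitive_on L psi1 psi2 by split=> //; exact: L2on_integrable.
by split=> //; split=> //; exact: primitive_on_integrable p1.
Qed.

End AC.

(** * Smooth solutions are weak solutions *)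

Section weak.
Context {R : realType}.
Local Notation mu := (@lebesgue_measure R).
Variables (eps L M : R) (phi : nat -> R -> R -> R).
Hypotheses (L0 : 0 < L) (sa : smooth_adjoint eps L M phi).

Lemma integrable_opp (f : R -> R) (a b : R) : mu.-integrable `]a, b[ (EFin \o f) ->
  mu.-integrable `]a, b[ (EFin \o (fun x => - f x)).
Proof. by move=> i; have := integrableN i; apply. Qed.

Lemma Rintegral_opp (f : R -> R) (a b : R) : mu.-integrable `]a, b[ (EFin \o f) ->
  \int[mu]_(x in `]a, b[) - f x = - \int[mu]_(x in `]a, b[) f x.
Proof.
by move=> i; rewrite -mulN1r -RintegralZl//; apply: eq_Rintegral => x _; rewrite mulN1r.
Qed.

Lemma H2_smooth (f f1 f2 : R -> R) : continuous f2 ->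
  (forall x : R, is_derive x 1 f1 (f2 x)) -> (forall x : R, is_derive x 1 f (f1 x)) ->
  H2 L f f1 f2.
Proof.
move=> cf2 df1 df; have cf1 := is_derive_continuous df1.
split; first exact: L2on_continuous.
- move=> x; rewrite in_itv/= => /andP[x0 _].
  rewrite -Rintegral_oo_cc; last exact: integrable_oo.
  by rewrite (Rintegral_FTC x0 df1 cf2) addrC subrK.
- move=> x; rewrite in_itv/= => /andP[x0 _].
  rewrite -Rintegral_oo_cc; last exact: integrable_oo.
  by rewrite (Rintegral_FTC x0 df cf1) addrC subrK.
Qed.

(** The reverse of the integrations by parts that define the weak form; the boundary
    terms vanish by [B^* phi = 0] in the first and [psi = 0] in the second. *)
Lemma adjoint_form_smooth (s : R) (psi psi1 psi2 : R -> R) :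
  H2_H10 L psi psi1 psi2 ->
  adjoint_form eps L M (phi 1%N s) (phi 2%N s) psi psi1 psi2 =
  \int[mu]_(x in `]0, L[) (spatial_op eps M (fun j => phi j s) x * psi x).
Proof.
case=> hpsi psi0 psiL; have [p0 p1] := H2_primitive_on (ltW L0) hpsi.
have i0 := primitive_on_integrable (ltW L0) p0.
have i1 := primitive_on_integrable (ltW L0) p1.
have i2 : mu.-integrable `]0, L[ (EFin \o psi2) by have [] := p1.
have cf j : continuous (phi j s) by exact: is_derive_continuous (sa_dx sa s j).
have df j := sa_dx sa s j.
(* B is B^* phi and C collects the coefficients of psi_x after the first step *)
pose B x := eps * phi 2%N s x - delta eps M / 2 * phi 1%N s x.
pose B1 x := eps * phi 3%N s x - delta eps M / 2 * phi 2%N s x.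
pose C x := - eps * phi 3%N s x + delta eps M * phi 2%N s x.
pose C1 x := - eps * phi 4%N s x + delta eps M * phi 3%N s x.
have dB (x : R) : is_derive x 1 B (B1 x).
  rewrite /B; have h1 := df 1%N x; have h2 := df 2%N x; apply: is_derive_eq.
  by rewrite /B1 /GRing.scale/=; ring.
have dC (x : R) : is_derive x 1 C (C1 x).
  rewrite /C; have h1 := df 3%N x; have h2 := df 2%N x; apply: is_derive_eq.
  by rewrite /C1 /GRing.scale/=; ring.
have cB : continuous B by rewrite /B; continuity_by ltac:(exact: cf).
have cB1 : continuous B1 by rewrite /B1; continuity_by ltac:(exact: cf).
have cC : continuous C by rewrite /C; continuity_by ltac:(exact: cf).
have cC1 : continuous C1 by rewrite /C1; continuity_by ltac:(exact: cf).
have cD : continuous (fun x => delta eps M / 2 * phi 2%N s x) by continuity_by ltac:(exact: cf).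
have cE : continuous (fun x => M * phi 1%N s x) by continuity_by ltac:(exact: cf).
have B0 : B 0 = 0 := sa_B0 sa s.
have BL : B L = 0 := sa_BL sa s.
have EB := integration_by_parts_AC (ltW L0) p1 dB cB1.
have EC := integration_by_parts_AC (ltW L0) p0 dC cC1.
rewrite B0 BL !mul0r subrr sub0r in EB.
rewrite psi0 psiL !mulr0 subrr sub0r in EC.
have iBpsi2 := integrable_mul_bounded i2 cB.
have iB1 := integrable_mul_bounded i1 cB1.
have iC := integrable_mul_bounded i1 cC.
have iC1 := integrable_mul_bounded i0 cC1.
have iD := integrable_mul_bounded i1 cD.
have iE := integrable_mul_bounded i0 cE.
have mI : measurable (`]0, L[ : set (measurableTypeR R)) by [].
have := Rintegral_opp iC1 => /= nC1; have := Rintegral_opp iB1 => /= nB1.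
rewrite /adjoint_form.
have -> : \int[mu]_(x in `]0, L[)
   (Bstar eps M (phi 1%N s) (phi 2%N s) x * psi2 x +
    delta eps M / 2 * phi 2%N s x * psi1 x - M * phi 1%N s x * psi x) =
  \int[mu]_(x in `]0, L[) (B x * psi2 x) + \int[mu]_(x in `]0, L[) (delta eps M / 2 * phi 2%N s x * psi1 x)
  - \int[mu]_(x in `]0, L[) (M * phi 1%N s x * psi x).
  by rewrite -RintegralD// -RintegralB//; exact: (integrableD mI iBpsi2 iD).
have -> : \int[mu]_(x in `]0, L[) (spatial_op eps M (fun j => phi j s) x * psi x) =
  (- \int[mu]_(x in `]0, L[) (C1 x * psi x)) - \int[mu]_(x in `]0, L[) (M * phi 1%N s x * psi x).
  rewrite -nC1 -RintegralB//; last exact: integrable_opp.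
  by apply: eq_Rintegral => x _; rewrite /spatial_op /C1; ring.
congr (_ - _); rewrite -EC EB -nB1 -RintegralD//; last exact: integrable_opp.
by apply: eq_Rintegral => x _; rewrite /B1 /C; field.
Qed.

Lemma adjoint_solution_smooth (t : R) :
  adjoint_solution eps L M t (phi 0%N t) (phi 0%N) (phi 1%N) (phi 2%N).
Proof.
have cf j s : continuous (phi j s) by exact: is_derive_continuous (sa_dx sa s j).
split.
- by move=> s _; apply: L2on_continuous; exact: cf.
- move=> s0 _.
  have -> : (fun s => L2norm mu `]0, L[ (phi 0%N s \- phi 0%N s0)) =
    (fun s => (Num.sqrt (\int[mu]_(x in `]0, L[) ((phi 0%N s x - phi 0%N s0 x) ^+ 2)))%:E).
    apply/funext => s; rewrite L2norm_sqrt//.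
    by apply: integrable_oo; exact: (continuous_sqr (continuous_add (cf 0%N s) (continuous_opp (cf 0%N s0)))).
  apply: cvg_EFin; first exact: nearW.
  apply: cvg_within_filter.
  have c1 : continuous (fun z : R * R => (phi 0%N z.1 z.2 - phi 0%N s0 z.2) ^+ 2).
    have c0 : continuous (fun z : R * R => phi 0%N s0 z.2).
      by move=> z; apply: (@continuous_comp _ _ _ snd (phi 0%N s0)); [exact: cvg_snd|exact: cf].
    by continuity_by ltac:(first [exact: sa_cont sa 0%N | exact: c0]).
  have := continuous_Rintegral1 (a := 0) (b := L) c1 => /= c2.
  have e : Num.sqrt (\int[mu]_(x in `]0, L[) ((phi 0%N s0 x - phi 0%N s0 x) ^+ 2)) = 0.
    rewrite (_ : Rintegral _ _ _ = 0) ?sqrtr0//.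
    under eq_Rintegral do rewrite subrr expr0n/=.
    by rewrite /Rintegral integral0.
  have c3 : Num.sqrt (\int[mu]_(x in `]0, L[) ((phi 0%N s x - phi 0%N s0 x) ^+ 2)) @[s --> s0] -->
      Num.sqrt (\int[mu]_(x in `]0, L[) ((phi 0%N s0 x - phi 0%N s0 x) ^+ 2)).
    exact: (@continuous_comp _ _ _ _ Num.sqrt s0 (c2 s0) (@sqrt_continuous R _)).
  by rewrite e in c3; exact: c3.
- apply: aeW => s _; split; [|exact: sa_0 sa s|exact: sa_L sa s].
  apply: H2_smooth; [exact: cf|exact: sa_dx sa s 1%N|exact: sa_dx sa s 0%N].
- move=> f hf; have [j ->] : exists j, f = phi j.
    by case: hf => [->|[->|->]]; [exists 0%N|exists 1%N|exists 2%N].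
  by apply: L2on_rectangle; [exact: sa_cont sa j|exact: sa_meas sa j].
- move=> s psi psi1 psi2; rewrite in_itv/= => /andP[s0 st] hpsi.
  have [hpsi' _ _] := hpsi; have [p0 _] := H2_primitive_on (ltW L0) hpsi'.
  have i0 := primitive_on_integrable (ltW L0) p0.
  have cS := sa_cont_op sa.
  rewrite -(Rintegral_FTC st (is_derive_Rintegral (sa_cont sa 0%N) cS (fun s x => sa_time sa s x) i0)
    (continuous_Rintegral cS i0)).
  by apply: eq_Rintegral => r _; rewrite adjoint_form_smooth.
- exact: aeW.
Qed.

End weak.

(** * Weierstrass approximation *)

Section bernstein.
Context {R : realType}.
Implicit Types (phi psi : nat -> R) (t : R).

(** [(bernstein n phi).[t]] is the expectation of [phi] at the number of successes in
    [n] trials of probability [t], defined by conditioning on the first trial; all moment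
    computations become inductions without binomial coefficients. *)
Fixpoint bernstein n phi : {poly R} :=
  if n is n'.+1 then
    'X * bernstein n' (fun k => phi k.+1) + (1 - 'X) * bernstein n' phi
  else (phi 0%N)%:P.

Lemma bernsteinS n phi t : (bernstein n.+1 phi).[t] =
  t * (bernstein n (fun k => phi k.+1)).[t] + (1 - t) * (bernstein n phi).[t].
Proof. by rewrite /= !hornerE. Qed.

Lemma bernstein_lin n phi psi (c t : R) :
  (bernstein n (fun k => phi k + c * psi k)).[t] =
  (bernstein n phi).[t] + c * (bernstein n psi).[t].
Proof.
elim: n phi psi => [|n IH] phi psi; first by rewrite /= !hornerE.
by rewrite !bernsteinS !IH; ring.
Qed.

Lemma bernstein_cst n (c t : R) : (bernstein n (fun=> c)).[t] = c.
Proof.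
elim: n => [|n IH]; first by rewrite /= hornerE.
by rewrite bernsteinS IH; ring.
Qed.

Lemma bernstein_sqr n (c t : R) :
  (bernstein n (fun k => (k%:R + c) ^+ 2)).[t] =
  (n%:R * t + c) ^+ 2 + n%:R * (t * (1 - t)).
Proof.
elim: n c => [|n IH] c; first by rewrite /= hornerE; ring.
rewrite bernsteinS IH.
rewrite (_ : (fun k : nat => _) = (fun k : nat => (k%:R + (1 + c)) ^+ 2 : R)); last first.
  by apply/funext => k; rewrite -natr1 addrA.
by rewrite IH -natr1; ring.
Qed.

Lemma bernstein_le n phi psi t : 0 <= t <= 1 ->
  (forall k, (k <= n)%N -> phi k <= psi k) ->
  (bernstein n phi).[t] <= (bernstein n psi).[t].
Proof.
move=> t01; have /andP[t0 t1] := t01.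
elim: n phi psi => [|n IH] phi psi h; first by rewrite /= !hornerE h.
rewrite !bernsteinS; apply: lerD; apply: ler_wpM2l; rewrite ?subr_ge0//; apply: IH => k kn.
- by apply: h.
- by apply: h; exact: leqW.
Qed.

(** Heine's theorem, from the covering form of the compactness of [[a, b]]. *)
Lemma uniform_continuity (f : R -> R) (a b e : R) : continuous f -> 0 < e ->
  exists2 d : R, 0 < d & forall x y, x \in `[a, b] -> `|x - y| < d -> `|f x - f y| < e.
Proof.
move=> cf e0.
have /compact_near_coveringP cov := @segment_compact R a b.
have := cov R (0^'+) (fun d x => forall y, `|x - y| < d -> `|f x - f y| < e) _.
case.
  move=> x _.
  have /cvgrPdist_lt/(_ (e / 2)) := cf x; case; first by rewrite divr_gt0.
  move=> r /= r0 hr.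
  exists (ball x (r / 2), [set d | d < r / 2]) => /=.
    split; first by apply: nbhsx_ballx; rewrite divr_gt0.
    by apply: nbhs_right_lt; rewrite divr_gt0.
  move=> [x' d]/= [xx' dr] y x'y.
  have h1 : `|f x - f x'| < e / 2.
    apply: hr => /=; apply: lt_trans xx' _; lra.
  have h2 : `|f x - f y| < e / 2.
    apply: hr => /=; rewrite (_ : x - y = (x - x') + (x' - y)); last by ring.
    apply: le_lt_trans (ler_normD _ _) _; have : `|x - x'| < r / 2 := xx'; lra.
  rewrite (_ : f x' - f y = (f x - f y) - (f x - f x')); last by ring.
  apply: le_lt_trans (ler_normB _ _) _; lra.
move=> d /= d0 hd; exists (d / 2); first by rewrite divr_gt0.
move=> x y xab xy; apply: (hd (d / 2)) xy => //.
  by rewrite /= sub0r normrN gtr0_norm ?divr_gt0//; lra.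
by rewrite divr_gt0.
Qed.

(** Bernstein's proof: by uniform continuity [f x - f y] is at most
    [e / 2 + K (x - y)^2], and the variance of the mean of [n] trials is at most
    [1 / (4 n)]. *)
Lemma weierstrass (f : R -> R) (e : R) : continuous f -> 0 < e ->
  exists q : {poly R}, forall t, 0 <= t <= 1 -> `|f t - q.[t]| <= e.
Proof.
move=> cf e0.
have e20 : 0 < e / 2 by rewrite divr_gt0.
have [d d0 hd] := @uniform_continuity f 0 1 (e / 2) cf e20.
have [C C0 hC] : exists2 C, 0 <= C & forall x, 0 <= x <= 1 -> `|f x| <= C.
  have cf2 : continuous (fun z : R * R => f z.2).
    by move=> z; apply: continuous_comp; [exact: cvg_snd|exact: cf].
  have [D D0 hD] := bounded_rectangle 0 0 0 1 cf2.
  exists D => // x xI; apply: (hD 0); rewrite in_itv/=//.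
  by rewrite lexx.
pose K := 2 * C / d ^+ 2.
have K0 : 0 <= K by apply: divr_ge0; [exact: mulr_ge0|exact: sqr_ge0].
have hK x y : 0 <= x <= 1 -> 0 <= y <= 1 -> `|f x - f y| <= e / 2 + K * (y - x) ^+ 2.
  move=> x01 y01; have [xy|xy] := ltP `|x - y| d.
    have := hd x y; rewrite in_itv/= => /(_ x01 xy) /ltW h.
    by rewrite (le_trans h)// lerDl mulr_ge0// sqr_ge0.
  have h1 : d ^+ 2 <= (y - x) ^+ 2.
    by rewrite -(real_normK (num_real (y - x))) distrC ler_sqr ?nnegrE// ltW.
  have : 2 * C <= K * (y - x) ^+ 2.
    by rewrite /K mulrAC ler_pdivlMr ?exprn_gt0// ler_wpM2l// mulr_ge0.
  have := ler_normB (f x) (f y); have := hC x x01; have := hC y y01; lra.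
have [n hn] : exists n : nat, K / e < n.+1%:R.
  by exists (Num.truncn (K / e)); exact: truncnS_gt.
have n0 : (0 : R) < n.+1%:R by rewrite ltr0n.
exists (bernstein n.+1 (fun k => f (k%:R / n.+1%:R))) => t t01.
have fE : f t = (bernstein n.+1 (fun=> f t)).[t] by rewrite bernstein_cst.
pose g k : R := e / 2 + K * (k%:R / n.+1%:R - t) ^+ 2.
have gE : (bernstein n.+1 g).[t] = e / 2 + K / n.+1%:R * (t * (1 - t)).
  rewrite (_ : g = fun k : nat => e / 2 + (K / n.+1%:R ^+ 2) * (k%:R + - (n.+1%:R * t)) ^+ 2).
    rewrite bernstein_lin bernstein_cst bernstein_sqr.
    by move: (n.+1%:R : R) (lt0r_neq0 n0) => N N0; field.
  by apply/funext => k; rewrite /g; move: (n.+1%:R : R) (lt0r_neq0 n0) => N N0; field.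
pose node (k : nat) : R := k%:R / n.+1%:R.
have kn01 k : (k <= n.+1)%N -> 0 <= node k <= 1.
  move=> kn; rewrite /node divr_ge0 ?ler0n//=.
  by rewrite ler_pdivrMr// mul1r ler_nat.
have h1 : (bernstein n.+1 (fun k => f t + (-1) * f (k%:R / n.+1%:R))).[t] <= (bernstein n.+1 g).[t].
  apply: bernstein_le => // k kn; have := hK t _ t01 (kn01 k kn).
  by rewrite mulN1r => /(le_trans (ler_norm _)).
have h2 : (bernstein n.+1 (fun k => - f t + 1 * f (k%:R / n.+1%:R))).[t] <= (bernstein n.+1 g).[t].
  apply: bernstein_le => // k kn; have := hK t _ t01 (kn01 k kn).
  by rewrite distrC mul1r [- f t + _]addrC => /(le_trans (ler_norm _)).
have ge : (bernstein n.+1 g).[t] <= e.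
  have : K / n.+1%:R <= e by rewrite ler_pdivrMr// mulrC -ler_pdivrMr// ltW.
  have : 0 <= K / n.+1%:R by rewrite divr_ge0.
  have : 0 <= t * (1 - t) <= 1 / 4.
    case/andP: t01 => t0 t1; rewrite mulr_ge0 ?subr_ge0//=; have := sqr_ge0 (t - 1 / 2); lra.
  rewrite gE; move: (K / _) (t * _) => u v /andP[v0 v1] u0 ue.
  have : u * v <= e * (1 / 4) by exact: ler_pM.
  move: (u * v) => w; lra.
move: (le_trans h1 ge) (le_trans h2 ge); rewrite !bernstein_lin !bernstein_cst mulN1r mul1r.
move=> {}h1 {}h2; rewrite ler_norml h1 andbT lerNl opprB addrC; exact: h2.
Qed.

End bernstein.

(** * Explicit modes of the adjoint system *)

Section modes.
Context {R : realType}.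

Lemma cbrt_cube (x : R) : cbrt x ^+ 3 = x.
Proof.
rewrite /cbrt exprMn -[X in _ * X]powR_mulrn ?powR_ge0// -powRrM mulVf ?pnatr_eq0// powRr1//.
rewrite [RHS]numEsg; congr (_ * _); have [x0|x0|<-] := ltrgtP 0 x.
- by rewrite gtr0_sg// expr1n.
- by rewrite ltr0_sg//; ring.
- by rewrite sgr0 expr0n.
Qed.

Lemma delta_cube (eps M : R) : 0 < eps -> delta eps M ^+ 3 = - 8 * eps ^+ 2 * M.
Proof.
move=> e0; rewrite /delta 2!exprMn cbrt_cube; congr (_ * M).
rewrite -[X in _ * X]powR_mulrn ?powR_ge0// -powRrM (_ : 2 / 3 * 3%:R = 2%:R :> R); last by field.
by rewrite powR_mulrn ?ltW//; ring.
Qed.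

(** Functions of this form are stable under differentiation, which acts linearly on
    [(A, B)]. *)
Definition osc (a w A B x : R) : R := expR (a * x) * (A * sin (w * x) + B * cos (w * x)).

Lemma is_derive_osc (a w A B x : R) :
  is_derive x 1 (osc a w A B) (osc a w (a * A - w * B) (a * B + w * A) x).
Proof.
have dl (k : R) : is_derive x 1 (fun y => k * y) k.
  by apply: is_derive_eq; rewrite /GRing.scale/= mulr1.
have de := is_derive_comp (dl a) (is_derive_expR (a * x)).
have ds := is_derive_comp (dl w) (is_derive_sin (w * x)).
have dc := is_derive_comp (dl w) (is_derive_cos (w * x)).
rewrite /osc; apply: is_derive_eq.
by rewrite /GRing.scale/=; ring.
Qed.

Fixpoint osc_coef (a w : R) (j : nat) : R * R :=
  if j is j'.+1 then
    let c := osc_coef a w j' in (a * c.1 - w * c.2, a * c.2 + w * c.1)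
  else (1, 0).

Definition mode (a w : R) (j : nat) : R -> R :=
  osc a w (osc_coef a w j).1 (osc_coef a w j).2.

Lemma is_derive_mode a w j (x : R) : is_derive x 1 (mode a w j) (mode a w j.+1 x).
Proof. exact: is_derive_osc. Qed.

Definition mode_solution (T l a w : R) (j : nat) (s x : R) : R :=
  expR (l * (s - T)) * mode a w j x.

(** With [a = delta / (4 eps)] the choice of [delta] means [M = - 8 eps a^3], and
    then the spatial operator is a polynomial in [B^*] without constant term. It
    therefore has the Dirichlet eigenfunctions [exp (a x) sin (k pi x / L)] of [B^*],
    which satisfy all four boundary conditions. *)
Lemma smooth_adjoint_mode (eps L M T : R) (k : nat) : 0 < eps -> 0 < L ->
  let a := delta eps M / (4 * eps) in
  let w := k%:R * pi / L in
  smooth_adjoint eps L M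
    (mode_solution T (eps * (w ^+ 2 + a ^+ 2) * (w ^+ 2 + 5 * a ^+ 2)) a w).
Proof.
move=> e0 L0 a w; set l := eps * _ * _.
have dE : delta eps M = 4 * eps * a by rewrite /a; field; rewrite gt_eqF.
have ME : M = - 8 * eps * a ^+ 3.
  have := delta_cube M e0; rewrite dE => h.
  have e80 : - 8 * eps ^+ 2 != 0 by rewrite mulf_neq0 ?oppr_eq0 ?pnatr_eq0// expf_neq0 ?gt_eqF.
  by apply: (mulfI e80); rewrite -h; ring.
have sinL : sin (w * L) = 0.
  rewrite /w mulfVK ?gt_eqF//; elim: k {w l}=> [|k IH]; first by rewrite mul0r sin0.
  by rewrite -natr1 mulrDl mul1r sinDpi IH oppr0.
have dl (s : R) : is_derive s 1 (fun r => l * (r - T)) l.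
  by apply: is_derive_eq; rewrite /GRing.scale/= subr0 mulr1.
have de (s : R) := is_derive_comp (dl s) (is_derive_expR (l * (s - T))).
split.
- move=> j; rewrite /mode_solution.
  have c1 := is_derive_continuous de.
  have c2 := is_derive_continuous (is_derive_mode a w j).
  apply: continuous_mul => z.
    by apply: (@continuous_comp _ _ _ fst (fun s => expR (l * (s - T)))); [exact: cvg_fst|exact: c1].
  by apply: (@continuous_comp _ _ _ snd (mode a w j)); [exact: cvg_snd|exact: c2].
- move=> j; rewrite /mode_solution.
  have c1 := is_derive_continuous de.
  have c2 := is_derive_continuous (is_derive_mode a w j).
  have m1 := continuous_measurable_fun c1; have m2 := continuous_measurable_fun c2.
  apply: measurable_funM; first exact: (measurableT_comp m1 measurable_fst).
  exact: (measurableT_comp m2 measurable_snd).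
- move=> s j x; rewrite /mode_solution; have h := is_derive_mode a w j x.
  by apply: is_derive_eq; rewrite /GRing.scale/= ?mulr0 ?addr0.
- move=> c z s; rewrite /mode_solution.
  have dz : is_derive s 1 (fun r => z + c * r) c.
    by apply: is_derive_eq; rewrite /GRing.scale/= add0r mul1r mulr1.
  have dm := is_derive_comp dz (is_derive_mode a w 0 (z + c * s)).
  have h := de s; apply: is_derive_eq.
  rewrite /spatial_op /GRing.scale/= dE ME /mode /osc/= /l; ring.
- by move=> s; rewrite /mode_solution /mode /osc /= !mulr0 sin0 mulr0 mul0r addr0 !mulr0.
- by move=> s; rewrite /mode_solution /mode /osc /= sinL mulr0 mul0r addr0 !mulr0.
- by move=> s; rewrite /Bstar /mode_solution dE /mode /osc /= !mulr0 sin0 cos0; field.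
- by move=> s; rewrite /Bstar /mode_solution dE /mode /osc /= sinL; field.
Qed.

Lemma smooth_adjoint_lin (eps L M c : R) (phi psi : nat -> R -> R -> R) :
  smooth_adjoint eps L M phi -> smooth_adjoint eps L M psi ->
  smooth_adjoint eps L M (fun j s x => phi j s x + c * psi j s x).
Proof.
move=> f g; split.
- by move=> j; continuity_by ltac:(first [exact: sa_cont f j | exact: sa_cont g j]).
- move=> j; apply: measurable_funD; first exact: sa_meas f j.
  by apply: measurable_funM => //; exact: sa_meas g j.
- move=> s j x; have h1 := sa_dx f s j x; have h2 := sa_dx g s j x; apply: is_derive_eq.
  by rewrite /GRing.scale/=; ring.
- move=> d z s; have h1 := sa_ds f d z s; have h2 := sa_ds g d z s; apply: is_derive_eq.
  by rewrite /spatial_op /GRing.scale/=; ring.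
- by move=> s; rewrite (sa_0 f) (sa_0 g) mulr0 addr0.
- by move=> s; rewrite (sa_L f) (sa_L g) mulr0 addr0.
- move=> s; transitivity (Bstar eps M (phi 1%N s) (phi 2%N s) 0
      + c * Bstar eps M (psi 1%N s) (psi 2%N s) 0); first by rewrite /Bstar; ring.
  by rewrite (sa_B0 f) (sa_B0 g) mulr0 addr0.
- move=> s; transitivity (Bstar eps M (phi 1%N s) (phi 2%N s) L
      + c * Bstar eps M (psi 1%N s) (psi 2%N s) L); first by rewrite /Bstar; ring.
  by rewrite (sa_BL f) (sa_BL g) mulr0 addr0.
Qed.

End modes.

(** * Density of the final data *)

Section approx.
Context {R : realType}.
Variables (eps L M T : R).
Hypotheses (e0 : 0 < eps) (L0 : 0 < L).
Let a := delta eps M / (4 * eps).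

(** The modes at time [T] carry the common factor [exp (a x)], which is split off. *)
Definition final_profile (f : R -> R) := exists phi,
  smooth_adjoint eps L M phi /\ forall x, phi 0%N T x = expR (a * x) * f x.

Lemma final_profile_lin (f g h : R -> R) (c : R) :
  final_profile f -> final_profile g -> (forall x, h x = f x + c * g x) -> final_profile h.
Proof.
move=> [phi [sphi phiE]] [psi [spsi psiE]] hE.
exists (fun j s x => phi j s x + c * psi j s x); split; first exact: smooth_adjoint_lin.
by move=> x; rewrite phiE psiE hE; ring.
Qed.

Lemma final_profile_sin (k : nat) : final_profile (fun x => sin (k%:R * (pi / L * x))).
Proof.
eexists; split; first exact: (smooth_adjoint_mode M T k e0 L0).
move=> x; rewrite /mode_solution subrr mulr0 expR0 mul1r /mode /osc/= mul1r mul0r addr0.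
by rewrite !mulrA.
Qed.

(** Induction on the degree with [2 sin (k t) cos t = sin ((k+1) t) + sin ((k-1) t)]. *)
Lemma final_profile_sin_poly (q : {poly R}) (k : nat) :
  final_profile (fun x => sin (k%:R * (pi / L * x)) * q.[cos (pi / L * x)]).
Proof.
elim/poly_ind: q k => [|q c IH] k.
  apply: (@final_profile_lin _ _ _ 0 (final_profile_sin 0) (final_profile_sin 0)) => x.
  by rewrite horner0 mul0r sin0 !mulr0 addr0.
case: k => [|k].
  apply: (@final_profile_lin _ _ _ 0 (final_profile_sin 0) (final_profile_sin 0)) => x.
  by rewrite !mul0r sin0 !mul0r addr0.
have f1 := final_profile_lin (c := 1) (IH k.+2) (IH k) (fun=> erefl).
have f2 := final_profile_lin (c := c) (final_profile_sin 0) (final_profile_sin k.+1) (fun=> erefl).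
apply: (final_profile_lin (c := 2^-1) f2 f1) => x.
rewrite hornerMXaddC; move: (pi / L * x) (q.[_]) => t u.
have -> : k.+2%:R * t = k%:R * t + t + t by rewrite -!natr1; ring.
have -> : k.+1%:R * t = k%:R * t + t by rewrite -natr1; ring.
rewrite mul0r sin0 !(sinD, cosD); move: (sin (_ * t)) (cos (_ * t)) => S C.
have := cos2Dsin2 t; move: (sin t) (cos t) => s w sw.
transitivity (0 + c * (S * w + C * s) + 2^-1 * (((S * w + C * s) * w + (C * w - S * s) * s) * u
   + 1 * (S * (w ^+ 2 + s ^+ 2) * u))); last by rewrite sw mulr1.
by field.
Qed.

(** In the variable [c = cos (pi x / L)] the quotient of [exp (- a x) p] by
    [sin (pi x / L)] is a continuous function [G] on a compact part of [(-1, 1)], zero at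
    its ends because [p] vanishes at [al] and [be]; extended by zero, it is
    approximated by polynomials. *)
Lemma profile_approximation (al be eta : R) (p : R -> R) :
  0 < al -> al < be -> be < L -> continuous p -> p al = 0 -> p be = 0 -> 0 < eta ->
  exists phi, smooth_adjoint eps L M phi /\
    forall x, x \in `[0, L] ->
      `|phi 0%N T x - (if al < x < be then p x else 0)| <= eta.
Proof.
move=> al0 albe beL cp pal pbe eta0.
have pi0 : 0 < pi :> R := pi_gt0 R.
have piL0 : 0 < pi / L by rewrite divr_gt0.
have theta (x : R) : 0 <= x <= L -> 0 <= pi / L * x <= pi.
  move=> /andP[x0 xL]; rewrite mulr_ge0 ?(ltW piL0)//=.
  by rewrite mulrAC ler_pdivrMr// ler_pM2l.
have theta_inv (x : R) : pi / L * x * L / pi = x.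
  by move: (pi : R) (lt0r_neq0 pi0) (lt0r_neq0 L0) => P P0 L0'; field; rewrite P0.
pose c1 := cos (pi / L * be). pose c2 := cos (pi / L * al).
have al01 : 0 <= al <= L by apply/andP; split; lra.
have be01 : 0 <= be <= L by apply/andP; split; lra.
have c12 : c1 < c2.
  by rewrite ltr_cos ?in_itv/= ?theta// ltr_pM2l.
have pi_in : (pi : R) \in `[0, pi] by rewrite in_itv/= lexx andbT ltW.
have zero_in : (0 : R) \in `[0, pi] by rewrite in_itv/= lexx ltW.
have theta_in (x : R) : 0 <= x <= L -> pi / L * x \in `[0, pi].
  by move=> xL; rewrite in_itv/= theta.
have c1N1 : -1 < c1.
  rewrite -cospi ltr_cos ?theta_in//.
  by rewrite mulrAC ltr_pdivrMr// ltr_pM2l.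
have c21 : c2 < 1.
  by rewrite -cos0 ltr_cos ?theta_in// mulr_gt0.
pose X c := acos c * L / pi.
pose G c := expR (- (a * X c)) * p (X c) / sin (acos c).
have cX (c : R) : -1 < c < 1 -> {for c, continuous X}.
  by move=> h; apply: cvgM; [apply: cvgM; [exact: continuous_acos|exact: cvg_cst]|exact: cvg_cst].
have sin_acos0 (c : R) : -1 < c < 1 -> 0 < sin (acos c).
  by move=> /andP[h1 h2]; apply: sin_gt0_pi; rewrite acos_gt0 ?acos_ltpi ?h1 ?h2 ?ltW.
have cG (c : R) : -1 < c < 1 -> {for c, continuous G}.
  move=> h; apply: cvgM; first apply: cvgM.
  - apply: (@continuous_comp _ _ _ (fun c => - (a * X c)) expR); last exact: continuous_expR.
    by apply: cvgN; apply: cvgM; [exact: cvg_cst|exact: cX].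
  - by apply: (@continuous_comp _ _ _ X p); [exact: cX|exact: cp].
  - apply: cvgV; first by rewrite gt_eqF// sin_acos0.
    by apply: (@continuous_comp _ _ _ acos sin); [exact: continuous_acos|exact: continuous_sin].
(* composing with clamp extends G by its boundary values, that is by zero *)
pose clamp (c : R) := Num.max c1 (Num.min c2 c).
have clampI c : c1 <= clamp c <= c2.
  by rewrite /clamp le_max lexx/= ge_max (ltW c12)/= ge_min lexx.
have cclamp : continuous clamp.
  move=> c; apply: (@continuous_max _ _ (fun=> c1) (fun c => Num.min c2 c)); first exact: cvg_cst.
  by apply: (@continuous_min _ _ (fun=> c2) id); [exact: cvg_cst|exact: cvg_id].
have cF : continuous (G \o clamp).
  move=> c; apply: continuous_comp; first exact: cclamp.
  apply: cG; have /andP[h1 h2] := clampI c; by rewrite (lt_le_trans c1N1 h1) (le_lt_trans h2 c21).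
(* the interval [0, 1] of the approximation theorem is mapped onto [-1, 1] *)
have cF2 : continuous (fun t : R => (G \o clamp) (2 * t - 1)).
  have cl : continuous (fun t : R => 2 * t - 1).
    by move=> z; apply: cvgB; [exact: mulrl_continuous|exact: cvg_cst].
  by move=> t; apply: (@continuous_comp _ _ _ (fun t : R => 2 * t - 1) (G \o clamp)); [exact: cl|exact: cF].
(* the last factor absorbs the weight expR (a * x) on [0, L] *)
pose e := eta * expR (- (`|a| * L)).
have ee0 : 0 < e by rewrite mulr_gt0// expR_gt0.
have [q hq] := weierstrass cF2 ee0.
have [phi [sphi phiE]] := final_profile_sin_poly (q \Po ((1 + 'X) * (2^-1)%:P)) 1.
exists phi; split => // x; rewrite in_itv/= => xL; have /andP[x0 xL'] := xL.
have tx := theta _ xL.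
rewrite phiE mul1r; set t := pi / L * x.
have ct : 0 <= (1 + cos t) / 2 <= 1.
  by have := cos_geN1 t; have := cos_le1 t; move=> h1 h2; apply/andP; split; lra.
have := hq _ ct; rewrite (_ : 2 * ((1 + cos t) / 2) - 1 = cos t) /=; last by field.
rewrite (_ : (q \Po _).[_] = q.[(1 + cos t) / 2]); last by rewrite horner_comp !hornerE.
move: (q.[_]) => Q hQ.
have key : (if al < x < be then p x else 0) = expR (a * x) * (sin t * G (clamp (cos t))).
  have Xal : X c2 = al.
    by rewrite /X cosK ?in_itv/= ?theta// theta_inv.
  have Xbe : X c1 = be.
    by rewrite /X cosK ?in_itv/= ?theta// theta_inv.
  have cos_le (y z : R) : 0 <= y <= L -> 0 <= z <= L -> y <= z ->
      cos (pi / L * z) <= cos (pi / L * y).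
    by move=> yL zL yz; rewrite leNgt ltr_cos ?theta_in// -leNgt ler_pM2l.
  have [xal|xal] := leP x al.
    have h : clamp (cos t) = c2.
      rewrite /clamp min_l; last exact: cos_le.
      by rewrite max_r// ltW.
    by rewrite h /G Xal pal mulr0 mul0r !mulr0.
  have [xbe|xbe] /= := ltP x be; last first.
    have h : clamp (cos t) = c1.
      rewrite /clamp max_l// ge_min; apply/orP; right; exact: cos_le.
    by rewrite h /G Xbe pbe mulr0 mul0r !mulr0.
  have h : clamp (cos t) = cos t.
    rewrite /clamp min_r; last by apply: cos_le => //; exact: ltW.
    by rewrite max_r//; apply: cos_le => //; exact: ltW.
  have st : 0 < sin t.
    apply: sin_gt0_pi; rewrite mulr_gt0 ?(lt_trans al0 xal)//=.
    by rewrite /t mulrAC ltr_pdivrMr// ltr_pM2l// (lt_trans xbe beL).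
  rewrite h /G /X cosK ?theta_in//.
  rewrite theta_inv.
  rewrite expRN; move: (expR (a * x)) (sin t) (lt0r_neq0 (expR_gt0 (a * x))) (lt0r_neq0 st).
  by move=> E S E0 S0; field; rewrite ?E0 ?S0.
rewrite key -mulrBr -mulrBr normrM (ger0_norm (expR_ge0 _)).
have st1 : `|sin t| <= 1 by rewrite ler_norml sin_geN1 sin_le1.
have : `|sin t * (Q - G (clamp (cos t)))| <= e.
  by rewrite normrM -[leRHS]mul1r; apply: ler_pM => //; rewrite distrC.
move=> h; apply: (le_trans (ler_wpM2l (expR_ge0 _) h)).
rewrite /e mulrCA -[leRHS]mulr1 ler_wpM2l ?(ltW eta0)// -expRD -expR0 ler_expR.
rewrite subr_le0; apply: (le_trans (ler_norm _)).
by rewrite normrM (ger0_norm x0) ler_wpM2l.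
Qed.

End approx.

(** * Integrals of restricted functions and the Cauchy-Schwarz inequality *)

Section restriction.
Context {R : realType}.
Local Notation mu := (@lebesgue_measure R).

Lemma integrable_patch (f : R -> R) (a b c d : R) : continuous f ->
  mu.-integrable `]c, d[ (EFin \o (f \_ `]a, b[)).
Proof.
move=> cf; have i : mu.-integrable setT (EFin \o (f \_ `]a, b[)).
  by rewrite -restrict_EFin; apply/integrable_restrict => //; rewrite setTI; exact: integrable_oo.
exact: (integrableS _ _ _ i).
Qed.

Lemma Rintegral_patch (f : R -> R) (a b c d : R) : c <= a -> b <= d ->
  \int[mu]_(x in `]c, d[) (f \_ `]a, b[) x = \int[mu]_(x in `]a, b[) f x.
Proof.
move=> ca bd; rewrite -Rintegral_mkcondr setIidr//.
by apply: subset_itvW.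
Qed.

Lemma L2_distance_le (phi p : R -> R) (a b c d eta : R) :
  continuous phi -> continuous p -> c <= a -> b <= d -> c <= d ->
  (forall x, x \in `[c, d] -> `|phi x - (if a < x < b then p x else 0)| <= eta) ->
  \int[mu]_(x in `]c, d[) (phi x ^+ 2) - 2 * \int[mu]_(z in `]a, b[) (phi z * p z)
    + \int[mu]_(z in `]a, b[) (p z ^+ 2) <= eta ^+ 2 * (d - c).
Proof.
move=> cphi cp ca bd cd h.
have cc : continuous (fun _ : R => eta ^+ 2) by exact: cst_continuous.
have dc (x : R) : is_derive x 1 (fun x : R => eta ^+ 2 * x) (eta ^+ 2).
  by apply: is_derive_eq; rewrite /GRing.scale/= mulr1.
pose f x := - 2 * (phi x * p x) + p x ^+ 2.
have cf : continuous f by rewrite /f; continuity_by idtac.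
have cpp : continuous (fun x => phi x * p x) by continuity_by idtac.
have -> : \int[mu]_(x in `]c, d[) (phi x ^+ 2) - 2 * \int[mu]_(z in `]a, b[) (phi z * p z)
    + \int[mu]_(z in `]a, b[) (p z ^+ 2) =
    \int[mu]_(x in `]c, d[) (phi x ^+ 2 + (f \_ `]a, b[) x).
  rewrite RintegralD//; [|exact/integrable_oo/continuous_sqr|exact: integrable_patch].
  rewrite Rintegral_patch// /f RintegralD//; last 2 first.
  - by apply: integrable_oo; continuity_by idtac.
  - exact/integrable_oo/continuous_sqr.
  rewrite RintegralZl//; last exact: integrable_oo.
  by rewrite mulNr addrA.
rewrite mulrBr -(Rintegral_FTC cd dc cc).
apply: le_Rintegral => //.
- have i1 : mu.-integrable `]c, d[ (EFin \o (fun x => phi x ^+ 2)) by exact/integrable_oo/continuous_sqr.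
  have i2 : mu.-integrable `]c, d[ (EFin \o (f \_ `]a, b[)) by exact: integrable_patch.
  exact: (integrableD _ i1 i2).
- exact: integrable_oo.
move=> x xI; have /h hx : x \in `[c, d] by exact: subset_itv_oo_cc.
have e0 : 0 <= eta by exact: le_trans (normr_ge0 _) hx.
have {hx} : (phi x - (if a < x < b then p x else 0)) ^+ 2 <= eta ^+ 2.
  by rewrite -(real_normK (num_real (_ - _))) ler_sqr ?nnegrE.
rewrite patchE /f; case: ifPn => hx.
  rewrite mem_set/= ?in_itv//= => H; rewrite (_ : _ + _ = (phi x - p x) ^+ 2)//; ring.
by rewrite memNset/= ?in_itv/= ?(negbTE hx)// subr0 addr0.
Qed.

(** Stated with an upper bound [V > 0] of the second integral, so that the optimal
    multiple [k] of [f] needs no case distinction. *)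
Lemma cauchy_schwarz_continuous (u f : R -> R) (a b V : R) :
  L2on mu `]a, b[ u -> continuous f -> 0 < V ->
  \int[mu]_(s in `]a, b[) (f s ^+ 2) <= V ->
  (\int[mu]_(s in `]a, b[) (u s * f s)) ^+ 2 <= \int[mu]_(s in `]a, b[) (u s ^+ 2) * V.
Proof.
move=> L2u cf V0 fV.
have mI : measurable (`]a, b[ : set (measurableTypeR R)) by [].
have iu2 := L2on_integrable_sqr mI L2u; have iu := L2on_integrable L2u.
have ifu := integrable_mul_bounded iu cf.
have if2 := integrable_oo a b (continuous_sqr cf).
have -> : \int[mu]_(s in `]a, b[) (u s * f s) = \int[mu]_(s in `]a, b[) (f s * u s).
  by apply: eq_Rintegral => s _; rewrite mulrC.
set W := \int[mu]_(s in `]a, b[) (f s * u s); set U := \int[mu]_(s in `]a, b[) (u s ^+ 2).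
pose k := - (W / V).
have iZ (g : R -> R) (c : R) : mu.-integrable `]a, b[ (EFin \o g) ->
    mu.-integrable `]a, b[ (EFin \o (fun x => c * g x)).
  by move=> ig; have := integrableZl mI c ig; apply.
have iD : mu.-integrable `]a, b[ (EFin \o (fun x => u x ^+ 2 + 2 * k * (f x * u x))).
  exact: (integrableD mI iu2 (iZ _ (2 * k) ifu)).
have : 0 <= U + 2 * k * W + k ^+ 2 * \int[mu]_(s in `]a, b[) (f s ^+ 2).
  rewrite -RintegralZl// -RintegralZl// -RintegralD//; last exact: iZ.
  rewrite -RintegralD//; last exact: iZ.
  apply: Rintegral_ge0 => s _.
  by rewrite (_ : _ + _ = (u s + k * f s) ^+ 2) ?sqr_ge0//; ring.
have h : k ^+ 2 * \int[mu]_(s in `]a, b[) (f s ^+ 2) <= k ^+ 2 * V by rewrite ler_wpM2l// sqr_ge0.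
move=> /le_trans/(_ (lerD (lexx _) h)).
have id (x y : R) : x + 2 * (- (y / V)) * y + (- (y / V)) ^+ 2 * V = x - y ^+ 2 / V.
  by field; rewrite gt_eqF.
rewrite /k id.
by rewrite subr_ge0 ler_pdivrMr.
Qed.

End restriction.

(** * A polynomial bump *)

Section bump.
Context {R : realType}.
Local Notation mu := (@lebesgue_measure R).

(** Roots of order four at [a] and [b] are what the four integrations by parts of
    the transport comparison require. *)
Definition bump_poly (a b : R) : {poly R} := (('X - a%:P) * ('X - b%:P)) ^+ 4.

Definition bump (a b : R) (j : nat) (x : R) : R := (bump_poly a b)^`(j).[x].

Lemma is_derive_bump (a b : R) (j : nat) (x : R) :
  is_derive x 1 (bump a b j) (bump a b j.+1 x).
Proof. by rewrite /bump derivnS; exact: is_derive_poly. Qed.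

Lemma derivn_multiple_root (c : R) (n j : nat) (q : {poly R}) : (j < n)%N ->
  ((('X - c%:P) ^+ n * q)^`(j)).[c] = 0.
Proof.
elim: j n q => [|j IH] [|n] q // jn.
  by rewrite derivn0 hornerM horner_exp hornerXsubC subrr expr0n/= mul0r.
rewrite derivSn derivM deriv_exp derivXsubC mul1r /=.
have -> : ('X - c%:P) ^+ n *+ n.+1 * q + ('X - c%:P) ^+ n.+1 * q^`() =
  ('X - c%:P) ^+ n * (q *+ n.+1 + ('X - c%:P) * q^`()).
  by rewrite mulrnAl -mulrnAr exprSr -mulrA -mulrDr.
exact: IH.
Qed.

Lemma bump_boundary (a b : R) (j : nat) : (j < 4)%N -> bump a b j a = 0 /\ bump a b j b = 0.
Proof.
move=> j4; rewrite /bump /bump_poly exprMn; split; first exact: derivn_multiple_root.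
by rewrite mulrC; exact: derivn_multiple_root.
Qed.

Lemma bump_sqr_gt0 (a b : R) : a < b -> 0 < \int[mu]_(z in `]a, b[) (bump a b 0 z ^+ 2).
Proof.
move=> ab; pose w := (b - a) / 3; have w0 : 0 < w by rewrite divr_gt0// subr_gt0.
have cb := is_derive_continuous (is_derive_bump a b 0).
have [c cE] : exists c, c = ((w * w) ^+ 4) ^+ 2 by eexists.
have c0 : 0 < c by rewrite cE; do 2 apply: exprn_gt0; exact: mulr_gt0.
have cc : continuous (fun _ : R => c) by exact: cst_continuous.
have dc (x : R) : is_derive x 1 (fun x : R => c * x) c.
  by apply: is_derive_eq; rewrite /GRing.scale/= mulr1.
have wE : b = a + 3 * w by rewrite /w; field.
have w12 : a + w < b - w by rewrite wE; move: w w0 {cE wE c0 cc dc} => w w0; lra.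
apply: (@lt_le_trans _ _ (\int[mu]_(z in `]a + w, b - w[) (bump a b 0 z ^+ 2))); last first.
  apply: le_Rintegral_subset; [exact: continuous_sqr|by move=> x; exact: sqr_ge0| |].
    by rewrite lerDl ltW.
  by rewrite gerBl ltW.
apply: (@lt_le_trans _ _ (\int[mu]_(z in `]a + w, b - w[) c)).
  rewrite (Rintegral_FTC (ltW w12) dc cc).
  by rewrite -mulrBr mulr_gt0// subr_gt0.
apply: le_Rintegral => //; [exact: integrable_oo|exact/integrable_oo/continuous_sqr|].
move=> x /=; rewrite in_itv/= => /andP[h1 h2].
have key : w * w <= `|(x - a) * (x - b)|.
  rewrite normrM; apply: ler_pM; rewrite ?(ltW w0)//.
    by rewrite ler_normr lerBrDl ltW.
  by rewrite distrC ler_normr lerBrDr -lerBrDl ltW.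
rewrite /bump derivn0 /bump_poly !hornerE cE -(real_normK (num_real (((x - a) * (x - b)) ^+ 4))) normrX.
have ww0 : 0 <= w * w by rewrite mulr_ge0 ?ltW.
by apply: lerXn2r; rewrite ?nnegrE ?exprn_ge0//; apply: lerXn2r; rewrite ?nnegrE.
Qed.

End bump.

(** * The lower bound for the control cost *)

Section cost.
Context {R : realType}.
Local Notation mu := (@lebesgue_measure R).

(** The transposition identity at time [T], where the state vanishes. *)
Lemma null_control_duality (eps T L M : R) (y0 u : R -> R) (phi : nat -> R -> R -> R) :
  0 < L -> 0 < T -> smooth_adjoint eps L M phi -> null_controls eps T L M y0 u ->
  \int[mu]_(s in `]0, T[) (u s * phi 1%N s 0) = - \int[mu]_(x in `]0, L[) (y0 x * phi 0%N 0 x).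
Proof.
move=> L0 T0 sa [L2u [y [ysol yT]]].
have TT : T \in `[0, T] by rewrite in_itv/= lexx ltW.
have [L2y dual] := ysol T TT.
have cphi := sa_contx sa.
have := dual (phi 0%N T) (phi 0%N) (phi 1%N) (phi 2%N)
  (L2on_continuous _ _ (cphi 0%N T)) (adjoint_solution_smooth L0 sa T).
rewrite (_ : \int[mu]_(x in `]0, L[) (y T x * phi 0%N T x) = 0).
  by move/eqP; rewrite eq_sym addrC addr_eq0 => /eqP.
have mI : measurable (`]0, L[ : set (measurableTypeR R)) by [].
have my := L2on_measurable mI L2y.
rewrite /Rintegral (ae_eq_integral (fun=> 0%E))//; first by rewrite integral0.
- apply/measurable_EFinP/measurable_funM => //.
  by apply: measurable_funTS; apply: continuous_measurable_fun; exact: cphi.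
- case: yT => N [mN N0 subN]; exists N; split => // x /= nx; apply: subN => /= h.
  by apply: nx => xI; rewrite h// mul0r.
Qed.

(** Any adjoint solution with small trace at [0] and large scalar product with [y0]
    forces all null controls of [y0] to be large. *)
Lemma null_control_norm_ge (eps T L M A V : R) (y0 u : R -> R) (phi : nat -> R -> R -> R) :
  0 < L -> 0 < T -> smooth_adjoint eps L M phi -> null_controls eps T L M y0 u ->
  0 <= A -> 0 < V -> \int[mu]_(s in `]0, T[) (phi 1%N s 0 ^+ 2) <= V ->
  A ^+ 2 * V <= (\int[mu]_(x in `]0, L[) (y0 x * phi 0%N 0 x)) ^+ 2 ->
  (A%:E <= L2norm mu `]0%R, T[ u)%E.
Proof.
move=> L0 T0 sa nu A0 V0 hV hA.
have [L2u _] := nu.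
have mI : measurable (`]0, T[ : set (measurableTypeR R)) by [].
have iu2 := L2on_integrable_sqr mI L2u.
have cf : continuous (fun s => phi 1%N s 0) := continuous_sliceL 0 (sa_cont sa 1%N).
have := cauchy_schwarz_continuous L2u cf V0 hV.
rewrite (null_control_duality L0 T0 sa nu) sqrrN => /(le_trans hA).
rewrite ler_pM2r// => h; rewrite L2norm_sqrt// lee_fin.
by rewrite -(ger0_norm A0) -sqrtr_sqr ler_wsqrtr.
Qed.

Lemma delta_bound (eps M : R) : 0 < eps ->
  `|delta eps M| <= 2 * `|cbrt M| * (eps `^ (2 / 3)).
Proof.
move=> e0; rewrite /delta !normrM normrN normr_nat (ger0_norm (powR_ge0 _ _)).
by rewrite mulrAC.
Qed.

(** The initial datum is the bump placed so that the flow of speed [M] carries it onto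
    [(a, b)] at time [T] without leaving [(0, L)], which is possible because
    [T < L / |M|]. *)
Lemma control_cost_ge (M L T A : R) : M != 0 -> 0 < L -> 0 < T -> T < L / `|M| -> 0 < A ->
  exists2 k0 : R, 0 < k0 & forall eps : R, 0 < eps -> eps <= 1 -> eps `^ (2 / 3) <= k0 ->
    ((A * Num.sqrt eps)%:E <= control_cost eps T L M)%E.
Proof.
move=> M0 L0 T0 TL A0.
have MT : `|M| * T < L by rewrite mulrC -ltr_pdivlMr// normr_gt0.
(* positions at time T of the points that are in (0, L) at times 0 and T *)
pose lo := Num.max 0 (M * T). pose hi := Num.min L (L + M * T).
have lohi : lo < hi.
  have h : `|M * T| < L by rewrite normrM (gtr0_norm T0).
  move: h; rewrite ltr_norml => /andP[h1 h2].
  by rewrite gt_max !lt_min L0/=; apply/and3P; split; [rewrite -ltrBlDl sub0r|exact: h2|rewrite ltrDr].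
have lo0 : 0 <= lo by rewrite le_max lexx.
have loT : M * T <= lo by rewrite le_max lexx orbT.
have hiL : hi <= L by rewrite ge_min lexx.
have hiT : hi <= L + M * T by rewrite ge_min lexx orbT.
clearbody lo hi.
pose a := (2 * lo + hi) / 3. pose b := (lo + 2 * hi) / 3.
have ab : a < b by rewrite /a /b; lra.
have a0 : 0 < a by rewrite /a; lra.
have aT0 : 0 <= a - M * T by rewrite /a; lra.
have bL : b < L by rewrite /b; lra.
have bTL : b - M * T <= L by rewrite /b; lra.
clearbody a b.
have dp j (x : R) : is_derive x 1 (bump a b j) (bump a b j.+1 x) by exact: is_derive_bump.
have cp j : continuous (bump a b j) by exact: is_derive_continuous (dp j).
have pab := @bump_boundary R a b.
have G0 := bump_sqr_gt0 ab.
set G := \int[mu]_(z in _) _ in G0.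
pose m := 2 * `|cbrt M|.
pose C := \int[mu]_(z in `]a, b[) (2 * bump a b 4 z ^+ 2 + 2 * m ^+ 2 * bump a b 3 z ^+ 2).
have C0 : 0 <= C.
  by apply: Rintegral_ge0 => z _; apply: addr_ge0; apply: mulr_ge0; rewrite ?sqr_ge0// mulr_ge0 ?sqr_ge0.
pose K := 1 + T * (2 + 2 * G + C).
have K0 : 0 < K by rewrite /K ltr_wpDr// mulr_ge0 ?(ltW T0)// addr_ge0// addr_ge0// mulr_ge0// ltW.
pose c := G / (4 * (1 + G)).
have G1 : 0 < 1 + G by rewrite addr_gt0.
have c0 : 0 < c by rewrite divr_gt0// mulr_gt0.
(* the second bound keeps the pairing above G / 4, the third one makes the trace
   small compared with 1 / A *)
exists (Num.min 1 (Num.min (G / (2 * (1 + K))) (6 * c ^+ 2 / (A ^+ 2 * L * K)))).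
  rewrite !lt_min ltr01/=; apply/andP; split; apply: divr_gt0 => //.
  - by rewrite mulr_gt0// addr_gt0.
  - by rewrite mulr_gt0// exprn_gt0.
  - by rewrite !mulr_gt0// exprn_gt0.
move=> eps e0 e1; set k := eps `^ (2 / 3); rewrite !le_min => /and3P[k1 kG kA].
have k0 : 0 < k by exact: powR_gt0.
have ek : eps <= k by apply: ger1_powR; [rewrite e0|lra].
have dk := delta_bound M e0; rewrite -/m -/k in dk.
have kG' : k * (1 + K) <= G / 2.
  move: kG; rewrite ler_pdivlMr; last by rewrite mulr_gt0// addr_gt0.
  by move=> h; rewrite ler_pdivlMr// -mulrA [(1 + K) * 2]mulrC.
have kA' : A ^+ 2 * L * K * k <= 6 * c ^+ 2.
  by move: kA; rewrite ler_pdivlMr ?mulr_gt0 ?exprn_gt0// mulrC.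
(* the final datum approximates the bump up to k in squared L^2 norm *)
pose eta := Num.sqrt (k / L).
have eta0 : 0 < eta by rewrite sqrtr_gt0 divr_gt0.
have etaE : eta ^+ 2 * (L - 0) = k.
  by rewrite sqr_sqrtr ?subr0 ?divfK ?gt_eqF// divr_ge0 ?ltW.
have [phi [sa happ]] := profile_approximation M T e0 L0 a0 ab bL (cp 0%N) (pab 0%N isT).1 (pab 0%N isT).2 eta0.
have cphi := sa_contx sa.
have dist := L2_distance_le (cphi 0%N T) (cp 0%N) (ltW a0) (ltW bL) (ltW L0) happ.
rewrite etaE in dist.
have pT : pairing M T phi a b (bump a b) T = \int[mu]_(z in `]a, b[) (phi 0%N T z * bump a b 0 z).
  by apply: eq_Rintegral => z _; rewrite subrK.
rewrite -pT in dist.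
have [tr pr] := trace_pairing_bounds e0 L0 (ltW T0) sa dp pab (ltW ab) (ltW a0) aT0 (ltW bL) bTL
  k1 ek dk dist.
rewrite -/G -/C -/K in tr pr.
have pG : G / 4 <= pairing M T phi a b (bump a b) 0.
  apply: le_trans pr; move: (kG'); rewrite mulrDr mulr1; move: (k * K) => kK; lra.
(* the factor 1 / (1 + G) brings the norm of the initial datum below 1 *)
pose q x := bump a b 0 (x + M * T) / (1 + G).
have cl : continuous (fun x : R => x + M * T) by continuity_by idtac.
have cq : continuous q.
  have cq0 : continuous (fun x => bump a b 0 (x + M * T)).
    by move=> x; apply: (@continuous_comp _ _ _ (fun x : R => x + M * T) (bump a b 0)); [exact: cl|exact: cp].
  by rewrite /q; continuity_by idtac.
pose y0 := q \_ `]a - M * T, b - M * T[.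
have y0E (f : R -> R -> R) : (forall x, f x 0 = 0) -> \int[mu]_(x in `]0, L[) f x (y0 x) =
    \int[mu]_(x in `]a - M * T, b - M * T[) f x (q x).
  move=> f0; rewrite -(Rintegral_patch _ aT0 bTL); apply: eq_Rintegral => x _.
  by rewrite /y0 !patchE; case: ifPn.
have shift (h : R -> R) : continuous h ->
    \int[mu]_(x in `]a - M * T, b - M * T[) h (x + M * T) = \int[mu]_(z in `]a, b[) h z.
  by move=> ch; rewrite Rintegral_shift ?subrK// lerD2r ltW.
have cb0 := cp 0%N.
have y0sqr : \int[mu]_(x in `]0, L[) (y0 x ^+ 2) = G / (1 + G) ^+ 2.
  rewrite (y0E (fun _ v => v ^+ 2)); last by move=> x; rewrite expr0n.
  rewrite (shift (fun z => (bump a b 0 z / (1 + G)) ^+ 2)); last by continuity_by idtac.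
  rewrite [RHS]mulrC -RintegralZl//; last exact/integrable_oo/continuous_sqr.
  by apply: eq_Rintegral => z _; rewrite exprMn exprVn mulrC.
have y0phi : \int[mu]_(x in `]0, L[) (y0 x * phi 0%N 0 x) =
    pairing M T phi a b (bump a b) 0 / (1 + G).
  have cline : continuous (fun z => phi 0%N 0 (z - M * T + M * 0)).
    exact: (@continuous_sliceR _ (fun z : R * R => phi 0%N z.1 (z.2 - M * T + M * z.1)) 0
      (continuous_line (F := fun z => phi 0%N z.1 z.2) (M * T) M (sa_cont sa 0%N))).
  rewrite (y0E (fun x v => v * phi 0%N 0 x)); last by move=> x; rewrite mul0r.
  rewrite /pairing [RHS]mulrC -RintegralZl//; last by apply: integrable_oo; continuity_by idtac.
  rewrite -shift; last by continuity_by idtac.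
  apply: eq_Rintegral => x _; rewrite addrK mulr0 addr0 /q.
  by move: (bump _ _ _ _) (phi _ _ _) => v w; field; rewrite gt_eqF.
have iy0 : mu.-integrable `]0, L[ (EFin \o y0) by exact: integrable_patch.
have iy02 : mu.-integrable `]0, L[ (EFin \o (fun x => y0 x ^+ 2)).
  have := @integrable_patch _ (fun x => q x ^+ 2) (a - M * T) (b - M * T) 0 L (continuous_sqr cq).
  apply: eq_integrable => // x _; rewrite /= /y0 !patchE; case: ifPn => // _.
  by rewrite expr0n.
have mI : measurable (`]0, L[ : set (measurableTypeR R)) by [].
have L2y0 : L2on mu `]0, L[ y0.
  by apply: L2on_sqr_integrable => //; apply/measurable_EFinP; case/integrableP: iy0.
have y0norm : (L2norm mu `]0%R, L[ y0 <= 1)%E.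
  rewrite L2norm_sqrt// y0sqr lee_fin -[leRHS]sqrtr1 ler_wsqrtr//.
  by rewrite ler_pdivrMr ?exprn_gt0// mul1r; nra.
apply: (@le_trans _ _ (ereal_inf [set L2norm mu `]0%R, T[ u | u in null_controls eps T L M y0])); last first.
  by apply: ereal_sup_ubound; exists y0.
apply: le_ereal_inf_tmp => _ [u nu <-].
pose V := L / (6 * eps) * (k * K).
have V0 : 0 < V.
  by rewrite /V; apply: mulr_gt0; [rewrite divr_gt0// mulr_gt0|rewrite mulr_gt0].
apply: (null_control_norm_ge L0 T0 sa nu (V := V)) => //.
  by rewrite mulr_ge0 ?sqrtr_ge0// ltW.
rewrite y0phi exprMn sqr_sqrtr ?(ltW e0)//.
have -> : A ^+ 2 * eps * V = A ^+ 2 * L * K * k / 6 by rewrite /V; field; rewrite gt_eqF.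
apply: (@le_trans _ _ (c ^+ 2)); first by rewrite ler_pdivrMr// [c ^+ 2 * 6]mulrC.
have cD : c <= pairing M T phi a b (bump a b) 0 / (1 + G).
  by rewrite /c invfM mulrA ler_wpM2r// invr_ge0 ltW.
by apply: lerXn2r => //; rewrite nnegrE ?(ltW c0)// (le_trans (ltW c0) cD).
Qed.

End cost.

Theorem proposition2 (R : realType) (M L T : R) :
  M != 0 -> 0 < L -> 0 < T -> T < L / `|M| ->
  ((Num.sqrt eps)^-1%:E * control_cost eps T L M)%E
    @[eps --> (0 : R)^'+] --> +oo%E.
Proof.
move=> M0 L0 T0 TL; apply/cvgeyPge => B.
pose A := Num.max B 1; have A0 : 0 < A by rewrite lt_max ltr01 orbT.
have [k0 k00 hk0] := control_cost_ge M0 L0 T0 TL A0.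
have pc : (eps `^ (2 / 3) @[eps --> (0 : R)^'+] --> (0 : R)) by apply: powR_cvg0; rewrite divr_gt0.
near=> eps.
have e0 : 0 < eps by near: eps; exact: nbhs_right_gt.
have e1 : eps <= 1 by near: eps; exact: nbhs_right_le.
have ek : eps `^ (2 / 3) <= k0.
  near: eps; have := cvgr_le _ pc _ k00; apply.
have s0 : 0 < Num.sqrt eps by rewrite sqrtr_gt0.
apply: (@le_trans _ _ A%:E); first by rewrite lee_fin le_max lexx.
have -> : A%:E = ((Num.sqrt eps)^-1%:E * (A * Num.sqrt eps)%:E)%E.
  by rewrite -EFinM mulrC mulfK// gt_eqF.
by rewrite lee_pmul2l ?lte_fin ?invr_gt0//; exact: hk0.
Unshelve. all: by end_near. Qed.
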